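(* Let $n\ge1$ and let $I\subset[n]$ with $H(I)\ge3$. Uniformly for all such $I$ (and $n$) and any real $w$, \[ \mathbb{P}\left(C_I(\sigma)\le H(I)+w\sqrt{H(I)}\right)=\Phi(w)+O\left(\frac{\log H(I)}{\sqrt{H(I)}}\right),\qquad\Phi(w)=\frac1{\sqrt{2\pi}}\int_{-\infty}^we^{-\frac12t^2}\,dt. \]
   Context: $[n]=\{1,\ldots,n\}$; $I\subset[n]$ allows $I=[n]$. The probability $\mathbb{P}$ is with respect to a uniformly random permutation $\sigma$ in the symmetric group $\mathcal{S}_n$ on $[n]$. $C_I(\sigma)$ is the number of cycles of $\sigma$ whose lengths lie in $I$ (fixed points count as cycles of length 1), and $H(I)=\sum_{j\in I}1/j$. The constant implied by $O$ is absolute (independent of $n$, $I$, $w$). *)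

(* Defs.v *)
From mathcomp Require Import all_boot all_order all_algebra all_fingroup.
From mathcomp Require Import finmap.
From mathcomp Require Import all_classical all_reals all_analysis.

Set Implicit Arguments.
Unset Strict Implicit.
Unset Printing Implicit Defensive.

Import Order.TTheory GRing.Theory Num.Theory.

Local Open Scope ring_scope.

Definition unifP (R : realType) (T : finType) (E : pred T) : R :=
  #|[set x : T | E x]%SET|%:R / #|T|%:R.

(* The set {1, ..., n}. Permutations are taken in 'S_n, i.e. on
   'I_n = {0, ..., n-1}: relabelling the points does not affect cycle
   lengths. *)
Definition interval1 (n : nat) : {fset nat} := [fset j in iota 1 n]%fset.

(* [porbits s] is the set of all cycles of [s], each given as the set of its
   points and including the singletons of the fixed points. *)
Definition cycle_count (n : nat) (I : {fset nat}) (s : 'S_n) : nat :=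
  #|[set c in porbits s | #|c| \in I]%SET|.

Definition Hsum (R : realType) (I : {fset nat}) : R :=
  \sum_(j <- I) j%:R^-1.

Definition Phi (R : realType) (w : R) : R :=
  (Num.sqrt (2 * pi))^-1 *
  \int[lebesgue_measure]_(t in `]-oo, w]%classic) expR (- (2^-1 * t ^+ 2)).

(* Main.v *)
Require Import Defs.
From HB Require Import structures.
From mathcomp Require Import all_boot all_order all_algebra all_fingroup.
From mathcomp Require Import finmap.
From mathcomp Require Import all_classical all_reals all_analysis.
From mathcomp Require Import ring lra zify.

Set Implicit Arguments.
Unset Strict Implicit.
Unset Printing Implicit Defensive.

Import Order.TTheory GRing.Theory Num.Theory.
Import numFieldNormedType.Exports.

Local Open Scope ring_scope.

(** The number [W] of cycles with lengths in [I] is shown to be asymptotically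
    normal by Stein's method, applied directly to [W].

    Everything that is needed about permutations follows from one recursion
    ([avg_rec]): the cycle of a fixed point has uniformly distributed length,
    and the other points carry a uniform permutation. Writing [E_n] for averages
    over the permutations of [n] points and [H] for [H(I)], it has two
    consequences.
    - The size bias formula ([avg_size_bias]): [E_n (W g(W))] is the sum of
      [E_(n-j) (g(W+1)) / j] over [j] in [I].
    - Slow variation in [n] ([avg_continuity]): if [g] has increments at most
      [D], then [E_n (g(W))] and [E_(n-m) (g(W))] differ by at most
      [5 D #|I| / n] for [m <= n / 2], since each average is nearly the mean of
      the preceding ones.
    Hence [E (W g(W)) = H E (g(W+1)) + O(D H #|I| / n)] ([avg_stein]), an
    approximate form of the identity that characterizes the Poisson law of
    parameter [H]. When [I] lies in [[1, n / H]] the error is [O(D)].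

    A variable that satisfies this identity up to [O(D)] is within
    [O(1 / sqrt H)] of normal ([normal_approximation]). Suitable choices of [g]
    give first a variance of order [H] and point probabilities of order
    [1 / sqrt H]; then [g] is the solution [f] of Stein's equation
    [f'(x) - x f(x) = 1_{x <= w} - Phi(w)] in the standardized variable. The
    bounds on [f] come from Mills' ratio, and the point probabilities control
    the jump of [f'] at [w].

    For general [I], the lengths above [n / H] are set aside. Their harmonic sum
    is at most [1 + ln H] ([Hsum_large_le]), so that the number of such cycles
    exceeds [3 ln H] with probability [O(1 / sqrt H)], by factorial moments
    ([tail_bound]). This replaces the threshold [H + w sqrt H] by one that
    differs by [O(ln H)], and changes the parameter by [O(ln H)]; the effect on
    [Phi] is [O(ln H / sqrt H)] ([Phi_perturb]), the error of the theorem. *)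

(** * Splitting a permutation along the cycle of a point *)

Section CyclesOnASubset.
Variable T : finType.
Implicit Types (A B C : {set T}) (s u v : {perm T}) (x y : T).

Lemma perm_onX A s i : perm_on A s -> perm_on A (s ^+ i)%g.
Proof.
move=> sA; elim: i => [|i IH]; first by rewrite expg0 perm_on1.
by rewrite expgS perm_onM.
Qed.

(** Permutations with disjoint supports commute, so the powers of [u * v] act
    on the support of [u] as those of [u]. *)
Lemma porbit_mulr B C u v x : perm_on B u -> perm_on C v -> [disjoint B & C] ->
  x \in B -> porbit (u * v)%g x = porbit u x.
Proof.
move=> uB vC dBC xB.
have e i : (((u * v) ^+ i) x = (u ^+ i) x)%g.
  rewrite expgMn; last exact: perm_onC dBC.
  rewrite permM (out_perm (perm_onX i vC))//.
  rewrite (disjointFr dBC)// perm_closed//; exact: perm_onX.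
by apply/setP => y; apply/porbitP/porbitP => -[i ->]; exists i; rewrite ?e.
Qed.

Lemma porbit_sub A s x : perm_on A s -> x \in A -> porbit s x \subset A.
Proof.
move=> sA xA; apply/fintype.subsetP => y /porbitP[i ->].
by rewrite perm_closed//; exact: perm_onX.
Qed.

Lemma porbit_closed s x y : (s y \in porbit s x) = (y \in porbit s x).
Proof.
rewrite -!eq_porbit_mem; congr (_ == _).
by have := porbit_perm s 1 y; rewrite expg1.
Qed.

Lemma porbit_norm s x : s \in 'N(porbit s x | 'P)%g.
Proof. by apply/astabsP => y; rewrite /= apermE porbit_closed. Qed.

(** Exploring the cycle of [x] first: a permutation of [A] is the product of
    its restriction [u] to the cycle [B] of [x], which is cyclic on [B], and of
    an arbitrary permutation [v] of the rest of [A]. *)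
Lemma sum_by_cycle (V : nmodType) A x (F : {perm T} -> V) : x \in A ->
  \sum_(s | perm_on A s) F s =
  \sum_(B : {set T} | (B \subset A) && (x \in B))
    \sum_(u | perm_on B u && (porbit u x == B))
      \sum_(v | perm_on (A :\: B)%SET v) F (u * v)%g.
Proof.
move=> xA.
rewrite (partition_big (fun s => porbit s x)
          (fun B : {set T} => (B \subset A) && (x \in B)))/=; last first.
  by move=> s sA; rewrite porbit_sub// porbit_id.
apply: eq_bigr => B /andP[BA xB].
have dB : [disjoint B & (A :\: B)%SET] by rewrite disjoint_sym finset.disjoints_subset finset.subsetDr.
rewrite pair_big/=.
rewrite (reindex_onto (fun p : {perm T} * {perm T} => (p.1 * p.2)%g)
   (fun s => (restr_perm B s, ((restr_perm B s)^-1 * s)%g)))/=; last first.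
  by move=> s _; rewrite mulKVg.
apply: eq_bigl => -[u v] /=; apply/idP/idP.
- case/andP => /andP[uvA /eqP porb] /eqP[eu ev].
  have uvN : (u * v)%g \in 'N(B | 'P)%g by rewrite -porb porbit_norm.
  have uB : perm_on B u by rewrite -eu restr_perm_on.
  have vAB : perm_on (A :\: B)%SET v.
    apply/fintype.subsetP => y; rewrite !inE => vy; apply/andP; split.
      apply: contra vy => yB; rewrite -ev permM; set z := ((restr_perm B (u * v))^-1%g : {perm T}) y.
      have zB : z \in B by rewrite /z perm_closed// perm_onV// restr_perm_on.
      by rewrite -(restr_permE uvN zB) /z permKV.
    apply: contraR vy => yA; have := out_perm uvA yA; rewrite permM (out_perm uB) => [->//|].
    by apply: contra yA; exact/fintype.subsetP.
  by rewrite uB vAB -(porbit_mulr uB vAB dB xB) porb eqxx.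
- case/andP => /andP[uB /eqP porb] vAB.
  have porb' : porbit (u * v)%g x = B by rewrite (porbit_mulr uB vAB dB xB).
  rewrite porb' eqxx andbT; apply/andP; split.
    apply: perm_onM.
      by apply: fintype.subset_trans BA; exact: uB.
    by apply: (fintype.subset_trans vAB); exact: subsetDl.
  suff e : restr_perm B (u * v)%g = u by rewrite e mulKg.
  apply/permP => y; have [yB|yB] := boolP (y \in B); last first.
    by rewrite (out_perm uB yB) (out_perm (restr_perm_on _ _) yB).
  rewrite restr_permE//; last by rewrite -porb' porbit_norm.
  by rewrite permM (out_perm vAB)// (disjointFr dB)// perm_closed.
Qed.

End CyclesOnASubset.

Section CountingByCycle.
Variable T : finType.
Implicit Types (A B C : {set T}) (s u v : {perm T}) (x y : T).

Lemma sum_subsets_by_card (V : nmodType) A x n (h : nat -> V) :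
  x \in A -> #|A| = n.+1 ->
  \sum_(B : {set T} | (B \subset A) && (x \in B)) h #|B| =
  \sum_(k < n.+1) h k.+1 *+ 'C(n, k).
Proof.
move=> xA cA; have cAx : #|(A :\ x)%SET| = n by have := cardsD1 x A; rewrite xA cA => -[].
rewrite (reindex_onto (fun B => x |: B)%SET (fun B => B :\ x)%SET)/=; last first.
  by move=> B /andP[_ xB]; rewrite finset.setD1K.
transitivity (\sum_(B : {set T} | B \subset (A :\ x)%SET) h #|B|.+1).
  apply: eq_big => B.
    rewrite setU11 andbT finset.subUset finset.sub1set xA/= subsetD1; apply/andP/andP => -[BA].
      by move=> /eqP e; split=> //; rewrite -e setD11.
    by move=> xB; split=> //; rewrite finset.setU1K.
  case/andP=> /andP[_ _] /eqP e; rewrite cardsU1.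
  by have := setD11 x (x |: B)%SET; rewrite e => ->.
rewrite (partition_big (fun B : {set T} => inord #|B| : 'I_n.+1) xpredT)//=.
apply: eq_bigr => k _.
transitivity (\sum_(B : {set T} | (B \subset (A :\ x)%SET) && (#|B| == k)) h k.+1).
  have e : forall B : {set T}, (B \subset (A :\ x)%SET) -> (inord #|B| == k) = (#|B| == k :> nat).
    move=> B BA; rewrite -val_eqE/= inordK// ltnS -cAx; exact: subset_leq_card.
  apply: eq_big => B; first by apply: andb_id2l; exact: e.
  by move=> /andP[BA]; rewrite e// => /eqP ->.
by rewrite sumr_const; have := cards_draws (A :\ x)%SET k; rewrite cAx cardsE => <-.
Qed.

Lemma sum1_perm_on A : (\sum_(s | perm_on A s) 1)%N = (#|A|)`!.
Proof. by rewrite sum1_card card_perm. Qed.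

(** Strong induction on [#|A|]: [sum_by_cycle] for the constant 1 gives one linear equation for the numbers
    of cyclic permutations of the sets [B] with [x \in B \subset A]; the
    factorials satisfy the same equation, and only the coefficient of [A]
    itself is not covered by the induction hypothesis. *)
Lemma card_cyclic A x : x \in A ->
  (\sum_(u | perm_on A u && (porbit u x == A)) 1)%N = (#|A|.-1)`!.
Proof.
have [n] := ubnP #|A|; elim: n => // n IH in A x *; rewrite ltnS => An xA.
have tot := sum_by_cycle (fun _ => 1%N) xA.
have cA : #|A| = #|A|.-1.+1 by rewrite prednK// card_gt0; apply/set0Pn; exists x.
pose h k := (k.-1`! * (#|A| - k)`!)%N.
have := sum_subsets_by_card h xA cA.
rewrite (bigD1 A)/= ?subxx//.
have -> : (\sum_(k < #|A|.-1.+1) h k.+1 *+ 'C(#|A|.-1, k) = (#|A|)`!)%R.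
  rewrite (eq_bigr (fun=> (#|A|.-1)`!)); last first.
    move=> k _; rewrite /h /= (_ : #|A| - k.+1 = #|A|.-1 - k)%N; last by lia.
    by rewrite -[LHS]mulr_natl natn -(bin_fact (leq_ord k)).
  by rewrite sum_nat_const card_ord -factS -cA.
move: tot; rewrite [X in X = _](_ : _ = (#|A|)`!); last exact: sum1_perm_on.
rewrite (bigD1 A)/= ?subxx//.
set S1 := (X in _ = (_ + X)%R); set S2 := (X in (_ + X)%R = _ -> _).
have -> : S1 = S2.
  rewrite /S1 /S2; apply: eq_bigr => B /andP[/andP[BA xB] nBA].
  have BA' : (#|B| < #|A|)%N by rewrite proper_card// finset.properEneq nBA BA.
  rewrite (eq_bigr (fun=> (#|A| - #|B|)`!)); last first.
    by move=> u _; rewrite sum1_perm_on cardsDS.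
  rewrite /h -(IH B x)//; last exact: leq_trans An.
  by rewrite big_distrl/=; apply: eq_bigr => u _; rewrite mul1n.
rewrite {1}/h subnn fact0 muln1 => -> /addIn ->.
apply: eq_bigr => u _.
transitivity ((#|(finset.set0 : {set T})|)`!); first by rewrite cards0.
by rewrite -sum1_perm_on finset.setDv.
Qed.

Variable I : {fset nat}.

(** The count of [cycle_count], localized to the points of [A]: the recursion
    on the cycle of a point stays inside one ambient type. *)
Definition cycles_on A s : nat := (\sum_(c in (porbit s @: A)%SET) (#|c| \in I))%N.

Lemma cycles_onM A B x u v : x \in B -> B \subset A -> perm_on B u ->
  porbit u x = B -> perm_on (A :\: B)%SET v ->
  cycles_on A (u * v)%g = (cycles_on (A :\: B)%SET v + (#|B| \in I))%N.
Proof.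
move=> xB BA uB porb vAB.
have dB : [disjoint B & (A :\: B)%SET].
  by rewrite disjoint_sym finset.disjoints_subset finset.subsetDr.
have e1 : (porbit (u * v)%g @: B = [set B])%SET.
  rewrite (eq_in_imset (g := fun=> B)); last first.
    move=> y yB; rewrite (porbit_mulr uB vAB dB yB) -[RHS]porb.
    by apply/eqP; rewrite eq_porbit_mem porb.
  by apply/setP => c; rewrite inE; apply/imsetP/eqP => [[]//|->]; exists x.
have e2 : (porbit (u * v)%g @: (A :\: B) = porbit v @: (A :\: B))%SET.
  apply: eq_in_imset => y yB; rewrite (perm_onC uB vAB dB).
  by apply: (porbit_mulr vAB uB _ yB); rewrite disjoint_sym.
rewrite /cycles_on -{1}(finset.setID A B) (finset.setIidPr BA) imsetU e1 e2 big_setU1/= 1?addnC//.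
apply/imsetP => -[y yAB eB]; have := porbit_sub vAB yAB.
by rewrite -eB => /fintype.subsetP/(_ _ xB); rewrite inE xB.
Qed.

(** The averages [W] over the sets that avoid [x] are abstract here, because
    the lemma serves twice: inside the induction that shows that averages
    depend on cardinals only, and then to read off the recursion. The factor
    [n`!] is [(#|B| - 1)`! * (n.+1 - #|B|)`!] times the binomial coefficient
    that counts the possible cycles [B] of a given length. *)
Lemma sum_cycles_on_rec (R : realType) A x n (F : nat -> R)
    (W : nat -> (nat -> R) -> R) : x \in A -> #|A| = n.+1 ->
  (forall B F', B \subset A -> x \notin B ->
     \sum_(v | perm_on B v) F' (cycles_on B v) = (#|B|)`!%:R * W #|B| F') ->
  \sum_(s | perm_on A s) F (cycles_on A s) =
  n`!%:R * \sum_(k < n.+1) W (n - k)%N (fun c => F (c + (k.+1 \in I))%N).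
Proof.
move=> xA cA hW; rewrite (sum_by_cycle _ xA).
pose h k := (k.-1)`!%:R * ((n.+1 - k)`!%:R * W (n.+1 - k)%N (fun c => F (c + (k \in I))%N)).
transitivity (\sum_(B : {set T} | (B \subset A) && (x \in B)) h #|B|).
  apply: eq_bigr => B /andP[BA xB].
  transitivity (\sum_(u | perm_on B u && (porbit u x == B))
     \sum_(v | perm_on (A :\: B)%SET v) F (cycles_on (A :\: B)%SET v + (#|B| \in I))%N).
    apply: eq_bigr => u /andP[uB /eqP pB]; apply: eq_bigr => v vAB.
    by rewrite (cycles_onM xB BA uB pB vAB).
  rewrite (hW _ (fun c => F (c + (#|B| \in I))%N)) ?subsetDl ?inE ?xB//.
  rewrite cardsDS// cA sumr_const /h [RHS]mulr_natl; congr (_ *+ _).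
  by rewrite -(card_cyclic xB) sum1_card.
rewrite (sum_subsets_by_card _ xA cA) mulr_sumr; apply: eq_bigr => k _.
rewrite /h subSS /= mulrA -mulrnAl -natrM -mulr_natr -natrM; congr (_%:R * _).
by rewrite -(bin_fact (leq_ord k)); ring.
Qed.

End CountingByCycle.

(** * Uniform averages and the recursion for cycle counts *)

Section UniformMean.
Variables (R : realType) (T : finType).
Implicit Types F G : T -> R.

Definition mean F : R := (#|T|%:R)^-1 * \sum_x F x.

Lemma unifP_mean (E : pred T) : unifP R E = mean (fun x => (E x)%:R).
Proof.
rewrite /unifP /mean mulrC; congr (_ * _).
by rewrite -natr_sum -sum1_card big_mkcond; congr _%:R; apply: eq_bigr => x _; rewrite inE; case: (E x).
Qed.

Lemma eq_mean F G : F =1 G -> mean F = mean G.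
Proof. by move=> FG; rewrite /mean; congr (_ * _); exact: eq_bigr. Qed.

Lemma meanD F G : mean (fun x => F x + G x) = mean F + mean G.
Proof. by rewrite /mean big_split mulrDr. Qed.

Lemma meanZ (a : R) F : mean (fun x => a * F x) = a * mean F.
Proof. by rewrite /mean -mulr_sumr mulrCA. Qed.

Lemma meanN F : mean (fun x => - F x) = - mean F.
Proof. by rewrite /mean sumrN mulrN. Qed.

Lemma meanB F G : mean (fun x => F x - G x) = mean F - mean G.
Proof. by rewrite meanD meanN. Qed.

Lemma mean_sum n (F : 'I_n -> T -> R) :
  mean (fun x => \sum_(i < n) F i x) = \sum_(i < n) mean (F i).
Proof. by rewrite /mean exchange_big/= mulr_sumr. Qed.

Lemma ler_mean F G : (forall x, F x <= G x) -> mean F <= mean G.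
Proof. by move=> FG; rewrite /mean ler_wpM2l ?invr_ge0//; exact: ler_sum. Qed.

Lemma ler_norm_mean F : `|mean F| <= mean (fun x => `|F x|).
Proof.
rewrite /mean normrM ger0_norm ?invr_ge0// ler_wpM2l ?invr_ge0//.
exact: ler_norm_sum.
Qed.

Hypothesis T0 : (0 < #|T|)%N.

Lemma mean_cst (c : R) : mean (fun=> c) = c.
Proof.
by rewrite /mean sumr_const -[c *+ _]mulr_natl mulKf// pnatr_eq0 -lt0n.
Qed.

Lemma mean_le_cst (c : R) F : (forall x, F x <= c) -> mean F <= c.
Proof. by move=> Fc; rewrite -[leRHS]mean_cst; exact: ler_mean. Qed.

End UniformMean.

Section Averages.
Variables (R : realType) (I : {fset nat}).

Definition avg n (F : nat -> R) : R := mean (fun s : 'S_n => F (cycle_count I s)).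

Lemma cycle_count_cycles_on n (s : 'S_n) :
  cycle_count I s = cycles_on I [set: 'I_n]%SET s.
Proof.
rewrite /cycle_count /cycles_on -sum1_card big_mkcond [RHS]big_mkcond.
apply: eq_bigr => c _; rewrite !inE; have -> : (c \in porbits s) = (c \in (porbit s @: [set: 'I_n])%SET).
  by apply/imsetP/imsetP => -[y _ ->]; exists y; rewrite ?inE.
by case: (c \in _) => //=; case: (_ \in I).
Qed.

Lemma sum_cycles_on_setT n F :
  \sum_(s : 'S_n | perm_on [set: 'I_n]%SET s) F (cycles_on I [set: 'I_n]%SET s) =
  n`!%:R * avg n F.
Proof.
rewrite /avg /mean card_Sn mulVKf ?pnatr_eq0 -?lt0n ?fact_gt0//.
apply: eq_big => [s|s _]; last by rewrite cycle_count_cycles_on.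
by apply/fintype.subsetP => y; rewrite inE.
Qed.

(** Permutations of [A] and permutations of ['I_n] have the same averages when
    [#|A| = n], since both satisfy the same recursion in [n]. *)
Lemma sum_cycles_on n (T : finType) (A : {set T}) F : #|A| = n ->
  \sum_(s | perm_on A s) F (cycles_on I A s) = n`!%:R * avg n F.
Proof.
have [m] := ubnP n; elim: m => // m IH in n T A F *; rewrite ltnS => nm cA.
case: n => [|n] in nm cA *.
  have S0 (T' : finType) (A' : {set T'}) : #|A'| = 0%N ->
      \sum_(s | perm_on A' s) F (cycles_on I A' s) = F 0%N.
    move/cards0_eq => ->; rewrite (big_pred1 1%g); last first.
      move=> s; apply/idP/eqP => [s0|->]; last exact: perm_on1.
      by apply: (perm_on_id s0); rewrite cards0.
    by rewrite /cycles_on imset0 big_set0.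
  by rewrite S0// -sum_cycles_on_setT S0// cardsT card_ord.
have step (T' : finType) (A' : {set T'}) : #|A'| = n.+1 ->
  \sum_(s | perm_on A' s) F (cycles_on I A' s) =
  n`!%:R * \sum_(k < n.+1) avg (n - k)%N (fun c => F (c + (k.+1 \in I))%N).
  move=> cA'; have /card_gt0P[x xA] : (0 < #|A'|)%N by rewrite cA'.
  apply: (sum_cycles_on_rec _ xA cA') => B F' BA xB; apply: IH => //.
  apply: leq_trans nm; rewrite -cA'; apply: proper_card.
  by apply/properP; split => //; exists x.
by rewrite step// -sum_cycles_on_setT step// cardsT card_ord.
Qed.

(** The cycle of a given point has a uniformly distributed length, and the rest
    is a uniform permutation of the remaining points. *)
Lemma avg_rec n F : n.+1%:R * avg n.+1 F =
  \sum_(k < n.+1) avg (n - k)%N (fun c => F (c + (k.+1 \in I))%N).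
Proof.
apply: (@mulfI _ (n`!%:R)); first by rewrite pnatr_eq0 -lt0n fact_gt0.
rewrite mulrA -natrM mulnC -factS -sum_cycles_on_setT.
apply: (sum_cycles_on_rec _ (x := ord0)) => //; first by rewrite cardsT card_ord.
by move=> B F' _ _; exact: sum_cycles_on.
Qed.

End Averages.

(** * The size bias formula and the approximate Poisson identity *)

Section CesaroContinuity.
Variable R : realType.

(** If [a k] is within [c / k] of the mean [M k] of the preceding terms, then
    [M] moves by at most [c / k ^ 2] at each step, and so [a] moves little over
    any range [n - m, n] with [m <= n / 2]. *)
Lemma cesaro_stable (a : nat -> R) (c : R) n m :
  (forall k, `|k.+1%:R * a k.+1 - \sum_(i < k.+1) a i| <= c) ->
  (0 < n)%N -> (2 * m <= n)%N -> `|a n - a (n - m)%N| <= 5 * c / n%:R.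
Proof.
move=> ha n0 mn.
have c0 : 0 <= c by apply: le_trans (ha 0%N).
pose M k := (\sum_(i < k) a i) / k%:R.
have aM k : (0 < k)%N -> `|a k - M k| <= c / k%:R.
  case: k => // k _; rewrite ler_pdivlMr ?ltr0n// -[X in _ * X]ger0_norm ?ler0n// -normrM.
  by rewrite mulrBl divfK ?pnatr_eq0// mulrC.
have MS k : (0 < k)%N -> M k.+1 - M k = (a k - M k) / k.+1%:R.
  move=> k0; rewrite /M big_ord_recr/=; have : (k%:R : R) != 0 by rewrite pnatr_eq0 -lt0n.
  by have : (k.+1%:R : R) != 0 by []; rewrite -natr1 => h1 h2; field; rewrite h1 h2.
pose p := (n - m)%N; have p0 : (0 < p)%N by rewrite /p; lia.
have p0R : 0 < p%:R :> R by rewrite ltr0n.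
have Mdiff j : `|M (p + j)%N - M p| <= j%:R * (c / p%:R ^+ 2).
  elim: j => [|j IH]; first by rewrite addn0 subrr normr0 mul0r.
  rewrite addnS -natr1 mulrDl mul1r.
  rewrite (_ : _ - _ = (M (p + j)%N - M p) + (M (p + j).+1 - M (p + j)%N)); last by ring.
  apply: le_trans (ler_normD _ _) (lerD IH _).
  rewrite MS ?addn_gt0 ?p0// normrM [X in _ * X]ger0_norm ?invr_ge0//.
  apply: (@le_trans _ _ ((c / (p + j)%:R) / (p + j).+1%:R)).
    by rewrite ler_wpM2r ?invr_ge0// aM// addn_gt0 p0.
  rewrite expr2 invfM mulrA; apply: ler_pM; rewrite ?divr_ge0 ?invr_ge0//.
    by rewrite ler_wpM2l// lef_pV2 ?posrE ?ltr0n ?ler_nat ?addn_gt0 ?p0// leq_addr.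
  by rewrite lef_pV2 ?posrE ?ltr0n ?ler_nat//; lia.
have pm : (p + m = n)%N by rewrite /p subnK//; lia.
have := Mdiff m; rewrite pm => hM.
have h1 := aM n n0; have h2 := aM p p0.
rewrite (_ : a n - a p = (a n - M n) + ((M n - M p) - (a p - M p))); last by ring.
apply: le_trans (ler_normD _ _) _.
apply: le_trans (lerD h1 (le_trans (ler_normB _ _) (lerD hM h2))) _.
have n0R : 0 < n%:R :> R by rewrite ltr0n.
have np : n%:R <= 2 * p%:R :> R by rewrite -natrM ler_nat /p; lia.
have np' : p%:R^-1 <= 2 / n%:R :> R.
  by rewrite ler_pdivlMr// mulrC ler_pdivrMr.
have mn' : m%:R <= n%:R / 2 :> R by rewrite ler_pdivlMr// -natrM ler_nat mulnC.
have e1 : c / p%:R <= c * (2 / n%:R) by rewrite ler_wpM2l.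
have e2 : m%:R * (c / p%:R ^+ 2) <= n%:R / 2 * (c * (2 / n%:R * (2 / n%:R))).
  rewrite ler_pM// ?divr_ge0 ?exprn_ge0// ler_wpM2l// expr2 invfM.
  by apply: ler_pM; rewrite ?invr_ge0.
apply: le_trans (lerD (lexx _) (lerD e2 e1)) _.
rewrite le_eqVlt; apply/predU1P; left; field.
by rewrite gt_eqF.
Qed.

End CesaroContinuity.

Section SizeBias.
Variable R : realType.
Implicit Types (I : {fset nat}) (F G g : nat -> R).

Lemma perm_gt0 n : (0 < #|'S_n|)%N.
Proof. by apply/card_gt0P; exists 1%g. Qed.

Lemma avg_norm_le I n F (c : R) : (forall k, `|F k| <= c) -> `|avg I n F| <= c.
Proof.
move=> Fc; apply: le_trans (ler_norm_mean _) _.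
by apply: mean_le_cst; [exact: perm_gt0|move=> s].
Qed.

Lemma avgB I n F G : avg I n (fun k => F k - G k) = avg I n F - avg I n G.
Proof. exact: meanB. Qed.

Lemma avgD I n F G : avg I n (fun k => F k + G k) = avg I n F + avg I n G.
Proof. exact: meanD. Qed.

Lemma avgZ I n (a : R) F : avg I n (fun k => a * F k) = a * avg I n F.
Proof. exact: meanZ. Qed.

Lemma eq_avg I n F G : F =1 G -> avg I n F = avg I n G.
Proof. by move=> FG; apply: eq_mean => s; exact: FG. Qed.

Lemma sum_fset_segment I n (f : nat -> R) :
  \sum_(k < n) (k.+1 \in I)%:R * f k.+1 = \sum_(j <- I | (0 < j <= n)%N) f j.
Proof.
transitivity (\sum_(j <- iota 1 n | j \in I) f j).
  rewrite -(addn0 1%N) iotaDl big_map.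
  have -> : iota 0 n = index_iota 0 n by rewrite /index_iota subn0.
  rewrite big_mkord [RHS]big_mkcond/=; apply: eq_bigr => k _; rewrite add1n.
  by case: (_ \in I); rewrite ?mul1r ?mul0r.
rewrite -big_filter -[RHS]big_filter; apply: perm_big.
apply: uniq_perm; rewrite ?filter_uniq ?iota_uniq ?fset_uniq//.
by move=> j; rewrite !mem_filter mem_iota andbC add1n ltnS.
Qed.

Lemma sum_fset_ord I n (f : nat -> R) : (I `<=` interval1 n)%fset ->
  \sum_(k < n) (k.+1 \in I)%:R * f k.+1 = \sum_(j <- I) f j.
Proof.
move=> In; rewrite sum_fset_segment big_seq_cond [RHS]big_seq; apply: eq_bigl => j.
by apply: andb_idr => /(fsubsetP In); rewrite inE/= mem_iota.
Qed.

Lemma sum_fset_ord_le I n (f : nat -> R) : (forall k, 0 <= f k) ->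
  \sum_(k < n) (k.+1 \in I)%:R * f k.+1 <= \sum_(j <- I) f j.
Proof.
move=> f0; rewrite sum_fset_segment big_mkcond; apply: ler_sum => j _.
by case: ifP.
Qed.

Lemma card_fset_segment_le I n : \sum_(k < n) (k.+1 \in I)%:R <= (#|` I|)%:R :> R.
Proof.
have := @sum_fset_ord_le I n (fun=> 1) (fun=> ler01).
rewrite [leRHS](big_const_seq) count_predT iter_addr addr0; apply: le_trans.
by apply: ler_sum => k _; rewrite mulr1.
Qed.

(** Forgetting whether the first cycle is counted turns [avg_rec] into: the
    average for [n] is the mean of the averages for [0, ..., n - 1], up to
    [D * #|I| / n]. *)
Lemma avg_continuity I F (D : R) n m :
  (forall k, `|F k.+1 - F k| <= D) -> (0 < n)%N -> (2 * m <= n)%N ->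
  `|avg I n F - avg I (n - m)%N F| <= 5 * (D * (#|` I|)%:R) / n%:R.
Proof.
move=> FD; have D0 : 0 <= D by exact: le_trans (FD 0%N).
apply: (@cesaro_stable R (fun k => avg I k F)) => k.
rewrite avg_rec.
have -> : \sum_(i < k.+1) avg I i F = \sum_(i < k.+1) avg I (k - i)%N F.
  rewrite (reindex_inj rev_ord_inj)/=; apply: eq_bigr => i _.
  by congr avg; rewrite subSS.
rewrite -sumrB; apply: le_trans (ler_norm_sum _ _ _) _.
apply: (@le_trans _ _ (\sum_(i < k.+1) D * (i.+1 \in I)%:R)); last first.
  by rewrite -mulr_sumr ler_wpM2l// card_fset_segment_le.
apply: ler_sum => i _; rewrite -avgB; apply: avg_norm_le => c.
by case: (_ \in I); rewrite ?mulr1 ?mulr0 ?addn0 ?addn1 ?subrr ?normr0.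
Qed.

(** Marking one of the counted cycles, of length [j], removes it and leaves a
    uniform permutation of [n - j] points. The proof is by induction: splitting
    off the cycle of a point contributes a marked cycle with weight 1, while
    the marked cycles of the remaining points contribute [(n - j) / j], and
    [1 + (n - j) / j = n / j]. *)
Lemma avg_size_bias_ord I n g :
  avg I n (fun c => c%:R * g c) =
  \sum_(j < n) (j.+1 \in I)%:R / j.+1%:R * avg I (n - j.+1)%N (fun c => g c.+1).
Proof.
have [m] := ubnP n; elim: m => // m IH in n g *; rewrite ltnS => nm.
case: n => [|n] in nm *.
  rewrite big_ord0; transitivity (avg I 0 (fun=> 0 : R)); last exact/mean_cst/perm_gt0.
  apply: eq_mean => s; suff -> : cycle_count I s = 0%N by rewrite mul0r.
  apply/eqP; rewrite cards_eq0; apply/eqP/setP => c; rewrite !inE.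
  by apply/negbTE; rewrite negb_and; apply/orP; left; apply/imsetP => -[[]].
pose b k : R := (k.+1 \in I)%:R.
pose G c := g c.+1.
have n1 : (n.+1%:R : R) != 0 by [].
apply: (mulfI n1); rewrite avg_rec.
transitivity (\sum_(k < n.+1) (avg I (n - k)%N (fun c => c%:R * g (c + (k.+1 \in I))%N)
    + b k * avg I (n - k)%N G)).
  apply: eq_bigr => k _; rewrite -avgZ -avgD; apply: eq_avg => c.
  by rewrite /b /G; case: (_ \in I); rewrite ?addn1 ?addn0 ?mul0r ?mul1r ?addr0// -natr1 mulrDl mul1r.
rewrite big_split/=.
have -> : \sum_(k < n.+1) avg I (n - k)%N (fun c => c%:R * g (c + (k.+1 \in I))%N)
   = \sum_(j < n.+1) b j / j.+1%:R * (n - j)%:R * avg I (n - j)%N G.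
  (* Both orders of summation run over the triangle [j + k < n]. *)
  transitivity (\sum_(k < n.+1) \sum_(j < n.+1) if (j + k < n)%N then
     b j / j.+1%:R * avg I (n - j - k.+1)%N (fun c => G (c + (k.+1 \in I))%N) else 0).
    apply: eq_bigr => k _; rewrite IH; last by rewrite (leq_ltn_trans _ nm)// leq_subr.
    pose X j := b j / j.+1%:R * avg I (n - j - k.+1)%N (fun c => G (c + (k.+1 \in I))%N).
    rewrite -[RHS]big_mkcond/=.
    rewrite -[RHS](big_mkord (fun j => (j + k < n)%N) X).
    transitivity (\sum_(0 <= j < n - k) X j).
      rewrite big_mkord; apply: eq_bigr => j _; rewrite /X -subnDA -subnDA.
      by congr (_ * avg _ _ _); lia.
    rewrite (big_nat_widen 0%N (n - k) n.+1)/=; last by lia.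
    by apply: eq_bigl => j; lia.
  rewrite exchange_big/=; apply: eq_bigr => j _.
  rewrite -big_mkcond/= -mulr_sumr -[RHS]mulrA; congr (_ * _).
  have [nj|nj] := leqP n j.
    rewrite big1; first by rewrite (_ : n - j = 0)%N ?mul0r//; lia.
    by move=> k; lia.
  have -> : (n - j = (n - j.+1).+1)%N by lia.
  rewrite avg_rec.
  pose X k := avg I (n - j.+1 - k)%N (fun c => G (c + (k.+1 \in I))%N).
  transitivity (\sum_(0 <= k < (n - j.+1).+1) X k); last by rewrite big_mkord.
  rewrite (big_nat_widen 0%N (n - j.+1).+1 n.+1)/=; last by lia.
  rewrite big_mkord; apply: eq_big => k; first by lia.
  by move=> jk; rewrite /X; congr avg; lia.
rewrite -big_split/= mulr_sumr; apply: eq_bigr => j _; rewrite subSS -/G -/(b j).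
have jn : (j <= n)%N by rewrite -ltnS.
have j1 : (j.+1%:R : R) != 0 by [].
rewrite natrB// -[n.+1%:R]natr1; move: j1; rewrite -natr1 => j1.
by set A := avg _ _ _; set B := b _; field; exact: j1.
Qed.

Lemma avg_size_bias I n g : (I `<=` interval1 n)%fset ->
  avg I n (fun c => c%:R * g c) =
  \sum_(j <- I) j%:R^-1 * avg I (n - j)%N (fun c => g c.+1).
Proof.
move=> In; rewrite avg_size_bias_ord -(sum_fset_ord _ In).
by apply: eq_bigr => k _; rewrite -mulrA.
Qed.

(** The approximate Poisson identity [E (W g(W)) = H E (g(W + 1))]: in the size
    bias formula every average over [n - j] points is replaced by the average
    over [n] points. *)
Lemma avg_stein I n g (D : R) : (0 < n)%N -> (I `<=` interval1 n)%fset ->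
  (forall j, j \in I -> 2 * j <= n)%N ->
  (forall k, `|g k.+1 - g k| <= D) ->
  `|avg I n (fun c => c%:R * g c) - Hsum R I * avg I n (fun c => g c.+1)|
   <= Hsum R I * (5 * (D * (#|` I|)%:R) / n%:R).
Proof.
move=> n0 In I2 gD; rewrite avg_size_bias// /Hsum !mulr_suml -sumrB.
apply: le_trans (ler_norm_sum _ _ _) _.
rewrite big_seq [leRHS]big_seq; apply: ler_sum => j jI.
rewrite -mulrBr normrM ger0_norm ?invr_ge0// ler_wpM2l ?invr_ge0//.
by rewrite distrC; apply: avg_continuity => //; exact: I2.
Qed.

End SizeBias.

(** * Long cycles *)

Section LargeCycles.
Variable R : realType.
Implicit Types (I : {fset nat}) (n : nat).

Lemma Hsum_ge0 I : 0 <= Hsum R I.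
Proof. by apply: sumr_ge0 => j _; rewrite invr_ge0. Qed.

(** The size bias formula for [g c = 'C(c - 1, r)] expresses the factorial moment
    of order [r + 1] through those of order [r] for fewer points. *)
Lemma avg_binomial_le I n r : avg I n (fun c => 'C(c, r)%:R : R) <= Hsum R I ^+ r / r`!%:R.
Proof.
elim: r n => [|r IH] n.
  rewrite expr0 fact0 divr1; apply: mean_le_cst; first exact: perm_gt0.
  by move=> s; rewrite bin0.
have r1 : 0 < r.+1%:R :> R by rewrite ltr0n.
rewrite -(ler_pM2l r1) -avgZ.
have -> : avg I n (fun c => r.+1%:R * 'C(c, r.+1)%:R : R) = avg I n (fun c => c%:R * 'C(c.-1, r)%:R).
  by apply: eq_avg => c; rewrite -!natrM mul_bin_diag.
rewrite avg_size_bias_ord.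
have -> : r.+1%:R * (Hsum R I ^+ r.+1 / (r.+1)`!%:R) = Hsum R I * (Hsum R I ^+ r / r`!%:R).
  rewrite factS natrM exprS invfM; have : r`!%:R != 0 :> R by rewrite pnatr_eq0 -lt0n fact_gt0.
  have : r.+1%:R != 0 :> R by [].
  by move: (r.+1%:R : R) (r`!%:R : R) => a b a0 b0; field; rewrite a0 b0.
apply: (@le_trans _ _ (\sum_(j < n) (j.+1 \in I)%:R * (j.+1%:R^-1 * (Hsum R I ^+ r / r`!%:R)))).
  apply: ler_sum => j _; rewrite -mulrA ler_wpM2l// ler_wpM2l ?invr_ge0//.
apply: le_trans (@sum_fset_ord_le R I n (fun j => j%:R^-1 * (Hsum R I ^+ r / r`!%:R)) _) _.
  by move=> j; rewrite mulr_ge0 ?invr_ge0// divr_ge0 ?exprn_ge0 ?Hsum_ge0.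
by rewrite -mulr_suml /Hsum mulrC.
Qed.

Lemma exp_partial_sum_le (x : R) n : 0 <= x -> \sum_(k < n) x ^+ k / k`!%:R <= expR x.
Proof.
move=> x0; have nd : nondecreasing_seq (series (exp_coeff x)).
  by apply: nondecreasing_series => k _ _; rewrite /exp_coeff divr_ge0 ?exprn_ge0.
have := nondecreasing_cvgn_le nd (is_cvg_series_exp_coeff x) n.
by rewrite /series/= big_mkord.
Qed.

Lemma cycle_count_le I n (s : 'S_n) : (cycle_count I s <= n)%N.
Proof.
apply: (@leq_trans #|porbits s|).
  by apply: subset_leq_card; apply/fintype.subsetP => c; rewrite inE => /andP[].
by apply: leq_trans (leq_imset_card _ _) _; rewrite cardT size_enum_ord.
Qed.

(** By the binomial formula, [2 ^ c] is the sum of the ['C(c, r)]. *)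
Lemma avg_pow2_le I n : avg I n (fun c => 2 ^+ c : R) <= expR (Hsum R I).
Proof.
apply: le_trans (exp_partial_sum_le n.+1 (Hsum_ge0 I)).
apply: (@le_trans _ _ (\sum_(r < n.+1) avg I n (fun c => 'C(c, r)%:R : R))); last first.
  by apply: ler_sum => r _; exact: avg_binomial_le.
rewrite -mean_sum; apply: ler_mean => s; set c := cycle_count I s.
have cn : (c.+1 <= n.+1)%N by rewrite ltnS cycle_count_le.
rewrite -[2]/(1 + 1) exprDn (big_ord_widen _ (fun i => 1 ^+ (c - i) * 1 ^+ i *+ 'C(c, i)) cn) big_mkcond.
by apply: ler_sum => r _; rewrite !expr1n mulr1; case: ifP.
Qed.

Lemma expR_half_le2 : expR (2^-1 : R) <= 2.
Proof.
have := expR_ge1Dx (- 2^-1 : R); rewrite expRN => h.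
have e0 : 0 < expR (2^-1 : R) by exact: expR_gt0.
by have := ler_wpM2r (ltW e0) h; rewrite mulVf ?gt_eqF//; lra.
Qed.

(** Markov's inequality for [2 ^ c], weakened by [expR (1 / 2) <= 2]. *)
Lemma tail_bound I n (A : R) :
  mean (fun s : 'S_n => (A < (cycle_count I s)%:R)%R%:R : R) <= expR (Hsum R I - A / 2).
Proof.
rewrite expRD mulrC; apply: le_trans (ler_wpM2l (expR_ge0 _) (avg_pow2_le I n)).
rewrite -avgZ; apply: ler_mean => s; set c := cycle_count I s.
have [Ac|_] := boolP (A < c%:R)%R; last by rewrite mulr_ge0 ?expR_ge0// exprn_ge0.
rewrite expRN -ler_pdivrMl ?invr_gt0 ?expR_gt0// invrK mulr1.
apply: (@le_trans _ _ (expR (2^-1 * c%:R))).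
  by rewrite ler_expR mulrC ler_wpM2l ?invr_ge0// ltW.
by rewrite mulrC expRM_natl lerXn2r ?nnegrE ?expR_ge0 ?expR_half_le2.
Qed.

Lemma sum_inv_le_ln M n : (0 < M)%N -> (M <= n)%N ->
  \sum_(M <= k < n) (k.+1%:R : R)^-1 <= ln n%:R - ln M%:R.
Proof.
move=> M0; elim: n => [|n IH]; first by rewrite leqn0 => /eqP M00; rewrite M00 in M0.
rewrite leq_eqVlt => /predU1P[->|]; first by rewrite big_geq ?subrr.
rewrite ltnS => Mn; rewrite big_nat_recr//=.
have n0 : 0 < n%:R :> R by rewrite ltr0n (leq_trans M0).
have n1 : 0 < n.+1%:R :> R by rewrite ltr0n.
have : ln (n%:R : R) - ln n.+1%:R <= - n.+1%:R^-1.
  rewrite -ln_div ?posrE//.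
  have -> : n%:R / n.+1%:R = 1 + - n.+1%:R^-1 :> R.
    by move: n1; rewrite -natr1 => n1; field; rewrite gt_eqF.
  apply: le_ln1Dx; rewrite ltrN2 invf_lt1// ltr1n ltnS; exact: leq_trans M0 Mn.
have := IH Mn; move: (\sum_(M <= k < n) _) (n.+1%:R^-1 : R) (ln n%:R) (ln n.+1%:R) => x y u v; lra.
Qed.

(** A harmonic sum over lengths in [(n / H, n]]: the first term is at most 1 and
    the others are compared with the logarithm. *)
Lemma Hsum_large_le I n (H : R) : 1 <= H -> (I `<=` interval1 n)%fset ->
  (forall j, j \in I -> n%:R < j%:R * H) -> Hsum R I <= 1 + ln H.
Proof.
move=> H1 In hI; have H0 : 0 < H by exact: lt_le_trans H1.
pose N := Num.truncn (n%:R / H).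
have nH0 : 0 <= n%:R / H by rewrite divr_ge0// ltW.
have NI j : j \in I -> (N < j)%N.
  by move=> jI; rewrite /N truncn_lt_nat// ltr_pdivrMr// hI.
rewrite /Hsum -(sum_fset_ord _ In).
apply: (@le_trans _ _ (\sum_(N <= k < n) k.+1%:R^-1)).
  rewrite -(big_mkord xpredT (fun k => (k.+1 \in I)%:R * (k.+1%:R : R)^-1)).
  have [nN|Nn] := leqP n N.
    rewrite big_nat big1 ?sumr_ge0// => k /andP[_ kn].
    have [/NI|_] := boolP (k.+1 \in I); last by rewrite mul0r.
    by lia.
  rewrite (big_cat_nat (n := N))//=; last exact: ltnW.
  rewrite [X in X + _]big_nat [X in X + _]big1 ?add0r; last first.
    move=> k /andP[_ kn].
    have [/NI|_] := boolP (k.+1 \in I); last by rewrite mul0r.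
    by lia.
  by apply: ler_sum => k _; case: (_ \in I); rewrite ?mul1r ?mul0r ?invr_ge0.
have lnH : 0 <= ln H by exact: ln_ge0.
have [nN|Nn] := leqP n N; first by rewrite big_geq// addr_ge0.
rewrite big_ltn//; apply: lerD; first by rewrite invf_le1 ?ltr0n ?ler1n.
apply: le_trans (sum_inv_le_ln _ Nn) _ => //.
have n0 : 0 < n%:R :> R by rewrite ltr0n (leq_ltn_trans _ Nn).
rewrite lerBlDl -lnM ?posrE ?ltr0n// ler_ln ?posrE ?mulr_gt0 ?ltr0n ?(leq_ltn_trans _ Nn)//.
rewrite -ler_pdivrMr//; apply: ltW; rewrite /N.
by case/andP: (truncn_itv nH0).
Qed.

Lemma card_small_le I n (H : R) : 0 < H ->
  (I `<=` interval1 n)%fset -> (forall j, j \in I -> j%:R * H <= n%:R) ->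
  (#|` I|)%:R * H <= n%:R.
Proof.
move=> H0 In hI; rewrite -ler_pdivlMr//.
pose N := Num.truncn (n%:R / H).
have nH0 : 0 <= n%:R / H by rewrite divr_ge0// ltW.
have IN : (I `<=` interval1 N)%fset.
  apply/fsubsetP => j jI; have := fsubsetP In j jI; rewrite !inE /= !mem_iota => /andP[-> _].
  by rewrite /= add1n ltnS /N truncn_ge_nat// ler_pdivlMr// hI.
apply: (@le_trans _ _ N%:R); last by rewrite /N truncn_le.
rewrite ler_nat; apply: leq_trans (fsubset_leq_card IN) _.
by rewrite /interval1 card_fseq undup_id ?iota_uniq// size_iota.
Qed.

End LargeCycles.

(** * The normal distribution function *)

Section NormalLaw.
Variable R : realType.
Implicit Types x y w : R.

Definition phi x : R := (Num.sqrt (2 * pi))^-1 * expR (- (2^-1 * x ^+ 2)).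

Lemma phi_normal_pdf : phi = normal_pdf 0 1.
Proof.
apply/funext => x; rewrite normal_pdfE ?oner_eq0// /phi /normal_peak /normal_fun.
by congr (_^-1 * expR _); [congr Num.sqrt; ring|field].
Qed.

Lemma phi_gt0 x : 0 < phi x.
Proof. by rewrite mulr_gt0 ?expR_gt0// invr_gt0 sqrtr_gt0 mulr_gt0 ?pi_gt0. Qed.

Lemma integrable_phi (D : set R) : measurable D ->
  lebesgue_measure.-integrable D (EFin \o phi).
Proof.
move=> mD; rewrite phi_normal_pdf.
by apply: integrableS (integrable_normal_pdf 0 1) => //.
Qed.

Lemma PhiE w : Phi w = \int[lebesgue_measure]_(t in `]-oo, w]%classic) phi t.
Proof.
rewrite /Phi /phi -RintegralZl//; have c0 : (Num.sqrt (2 * pi : R)) != 0.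
  by rewrite sqrtr_eq0 -ltNge mulr_gt0 ?pi_gt0.
have := @integrableZl _ _ R lebesgue_measure _ _ (Num.sqrt (2 * pi)) _ (@integrable_phi `]-oo, w]%classic _).
move=> /(_ (measurable_itv _) (measurable_itv _)).
apply: eq_integrable => // t _ /=.
by rewrite /phi -EFinM mulrA mulfV// mul1r.
Qed.

(** Identifies [Phi] with the distribution function of the standard normal
    measure, whose limits at infinity are thereby known. *)
Lemma Phi_normal_prob w : (Phi w)%:E = normal_prob 0 1 `]-oo, w]%classic.
Proof.
rewrite PhiE /normal_prob phi_normal_pdf /Rintegral fineK//.
apply: integrable_fin_num => //; rewrite -phi_normal_pdf.
exact: integrable_phi.
Qed.

Lemma is_derive_Phi x : is_derive x 1 (@Phi R) (phi x).
Proof.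
have x1 : x < x + 1 by rewrite ltrDl.
have cphi : {for x, continuous phi}.
  by rewrite phi_normal_pdf; apply: continuous_normal_pdf; rewrite oner_eq0.
have := @continuous_FTC1 R phi -oo%O x (x + 1) x1 (integrable_phi (measurable_itv _)).
rewrite (_ : (fun y => _) = @Phi R); last by apply/funext => y; rewrite PhiE.
move=> /(_ (ltNyr _) cphi)[dP ePhi].
by apply: DeriveDef => //; rewrite -derive1E.
Qed.

Let idTR : measurableTypeR R -> R := idfun.
#[local] HB.instance Definition _ :=
  @isMeasurableFun.Build _ _ _ _ idTR (@measurable_id _ _ setT).

Let Phi_cdf w :
  (Phi w)%:E = cdf (idTR : {RV (normal_prob 0 1 : probability (measurableTypeR R) R) >-> R}) w.
Proof. by rewrite Phi_normal_prob /cdf /distribution /pushforward preimage_id. Qed.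

Lemma Phi_ge0 w : 0 <= Phi w.
Proof. by rewrite -lee_fin Phi_cdf cdf_ge0. Qed.

Lemma Phi_le1 w : Phi w <= 1.
Proof. by rewrite -lee_fin Phi_cdf cdf_le1. Qed.

Lemma Phi_nondecreasing x y : x <= y -> Phi x <= Phi y.
Proof. by move=> xy; rewrite -lee_fin !Phi_cdf cdf_nondecreasing. Qed.

Lemma Phi_near1 (e : R) : 0 < e -> exists M, forall y, M < y -> 1 - Phi y < e.
Proof.
move=> e0; have := @cvg_cdfy1 _ _ _ _
  (idTR : {RV (normal_prob 0 1 : probability (measurableTypeR R) R) >-> R}).
rewrite (_ : cdf _ = fun y => (Phi y)%:E); last by apply/funext => y; rewrite Phi_cdf.
move=> /fine_cvgP[_] /cvgrPdist_lt /(_ e e0)[M [_ hM]].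
by exists M => y /hM /=; apply: le_lt_trans; exact: ler_norm.
Qed.

Lemma Phi_near0 (e : R) : 0 < e -> exists M, forall y, y < M -> Phi y < e.
Proof.
move=> e0; have := @cvg_cdfNy0 _ _ _ _
  (idTR : {RV (normal_prob 0 1 : probability (measurableTypeR R) R) >-> R}).
rewrite (_ : cdf _ = fun y => (Phi y)%:E); last by apply/funext => y; rewrite Phi_cdf.
move=> /fine_cvgP[_] /cvgrPdist_lt /(_ e e0)[M [_ hM]].
by exists M => y /hM /=; rewrite sub0r normrN; apply: le_lt_trans; exact: ler_norm.
Qed.

End NormalLaw.

(** * Stein's equation *)

Section SteinSolution.
Variable R : realType.
Implicit Types x y w : R.

Lemma mean_value (f df : R -> R) (a b : R) :
  (forall x, is_derive x 1 f (df x)) -> a < b ->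
  exists c, [/\ a < c, c < b & f b - f a = df c * (b - a)].
Proof.
move=> fdf ab.
have cf : {within `[a, b], continuous f}%classic.
  apply: continuous_subspaceT => x; apply: differentiable_continuous.
  by apply/derivable1_diffP; case: (fdf x).
have [c] := @MVT R f df a b ab (fun x _ => fdf x) cf.
by rewrite in_itv/= => /andP[ac cb] ->; exists c.
Qed.

Lemma is_derive_phi x : is_derive x 1 (@phi R) (- (x * phi x)).
Proof.
rewrite /phi; apply: is_derive_eq.
by rewrite /GRing.scale /=; set s := (Num.sqrt _)^-1; set e := expR _; field.
Qed.

Lemma is_derive_Phi_phi (c x : R) :
  is_derive x 1 (fun y => c * Phi y + phi y) ((c - x) * phi x).
Proof.
have h1 := is_derive_Phi x; have h2 := is_derive_phi x.
by apply: is_derive_eq; rewrite /GRing.scale/=; ring.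
Qed.

(** The function [x * Phi y + phi y] of [y] decreases on [[x, +oo[], and it tends
    to [x] at infinity. *)
Lemma Mills_upper x : 0 <= x -> x * (1 - Phi x) <= phi x.
Proof.
rewrite le_eqVlt => /predU1P[<-|x0]; first by rewrite mul0r ltW ?phi_gt0.
rewrite leNgt; apply/negP => h.
have e0 : 0 < (x * (1 - Phi x) - phi x) / x by rewrite divr_gt0// subr_gt0.
have [M hM] := Phi_near1 e0.
pose y := Num.max M x + 1.
have yM : M < y by rewrite /y (@le_lt_trans _ _ (Num.max M x)) ?le_max ?lexx ?ltrDl.
have yx : x < y by rewrite /y (@le_lt_trans _ _ (Num.max M x)) ?le_max ?lexx ?orbT ?ltrDl.
have := hM y yM; rewrite ltr_pdivlMr// => hy.
have [c [xc cy]] := mean_value (is_derive_Phi_phi x) yx.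
have : (x - c) * phi c * (y - x) <= 0.
  rewrite mulr_le0_ge0// ?subr_ge0 ?(ltW yx)// mulr_le0_ge0 ?(ltW (phi_gt0 _))//.
  by rewrite subr_le0 ltW.
have := phi_gt0 y; move: hy h; set a := phi c; nra.
Qed.

Lemma Mills_lower x : x <= 0 -> - x * Phi x <= phi x.
Proof.
rewrite le_eqVlt => /predU1P[->|x0]; first by rewrite oppr0 mul0r ltW ?phi_gt0.
rewrite leNgt; apply/negP => h.
have e0 : 0 < (- x * Phi x - phi x) / - x.
  by rewrite divr_gt0// ?subr_gt0 ?oppr_gt0.
have [M hM] := Phi_near0 e0.
pose y := Num.min M x - 1.
have yM : y < M by rewrite /y (@lt_le_trans _ _ (Num.min M x)) ?ge_min ?lexx ?ltrBlDr ?ltrDl.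
have yx : y < x by rewrite /y (@lt_le_trans _ _ (Num.min M x)) ?ge_min ?lexx ?orbT ?ltrBlDr ?ltrDl.
have := hM y yM; rewrite ltr_pdivlMr ?oppr_gt0// => hy.
have [c [yc cx]] := mean_value (is_derive_Phi_phi x) yx.
have : 0 <= (x - c) * phi c * (x - y).
  by rewrite !mulr_ge0// ?subr_ge0 ?(ltW (phi_gt0 _)) ?ltW.
have := phi_gt0 y; move: hy h; set a := phi c; nra.
Qed.

Lemma phi_mono x y : `|x| <= `|y| -> phi y <= phi x.
Proof.
move=> xy; rewrite /phi ler_pM2l ?invr_gt0 ?sqrtr_gt0 ?mulr_gt0 ?pi_gt0//.
rewrite ler_expR lerN2 ler_pM2l ?invr_gt0//.
by rewrite -(real_normK (num_real x)) -(real_normK (num_real y)) ler_sqr ?nnegrE.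
Qed.

(** A common bound for both Mills ratios: beyond 1 the inequalities above bound
    them by 1, and on the unit interval [phi] is at least [phi 1]. *)
Definition Mills_const : R := 1 + (phi 1)^-1.

Lemma Mills_const_ge0 : 0 <= Mills_const.
Proof. by rewrite addr_ge0// invr_ge0 ltW ?phi_gt0. Qed.

Lemma Mills_upper_bounded x : 0 <= x -> (1 - Phi x) / phi x <= Mills_const.
Proof.
move=> x0; have p1 := @phi_gt0 R 1; have px := phi_gt0 x.
have i1 : 0 <= (phi 1 : R)^-1 by rewrite invr_ge0 ltW.
have [x1|x1] := leP x 1.
  apply: (@le_trans _ _ (phi 1)^-1); last by rewrite lerDr.
  rewrite ler_pdivrMr// -ler_pdivrMl ?invr_gt0// invrK.
  apply: (@le_trans _ _ (phi 1)); first by rewrite ler_piMr ?(ltW p1)// gerBl Phi_ge0.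
  by apply: phi_mono; rewrite !ger0_norm.
apply: (@le_trans _ _ 1); last by rewrite lerDl.
rewrite ler_pdivrMr// mul1r; apply: le_trans (Mills_upper x0).
by rewrite ler_peMl ?(ltW x1)// subr_ge0 Phi_le1.
Qed.

Lemma Mills_lower_bounded x : x <= 0 -> Phi x / phi x <= Mills_const.
Proof.
move=> x0; have p1 := @phi_gt0 R 1; have px := phi_gt0 x.
have i1 : 0 <= (phi 1 : R)^-1 by rewrite invr_ge0 ltW.
have [x1|x1] := leP (- 1) x.
  apply: (@le_trans _ _ (phi 1)^-1); last by rewrite lerDr.
  rewrite ler_pdivrMr// -ler_pdivrMl ?invr_gt0// invrK.
  apply: (@le_trans _ _ (phi 1)); first by rewrite ler_piMr ?(ltW p1)// Phi_le1.
  by apply: phi_mono; rewrite ler0_norm// normr1 lerNl.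
apply: (@le_trans _ _ 1); last by rewrite lerDl.
rewrite ler_pdivrMr// mul1r; apply: le_trans (Mills_lower x0).
by rewrite ler_peMl ?Phi_ge0// lerNr ltW.
Qed.

(** The bounded solution of Stein's equation
    [f'(x) - x f(x) = 1_{x <= w} - Phi(w)]. *)
Definition stein_sol w x : R :=
  if x <= w then (1 - Phi w) * (Phi x / phi x) else Phi w * ((1 - Phi x) / phi x).

Lemma stein_sol_ge0 w x : 0 <= stein_sol w x.
Proof.
have h u : 0 <= 1 - @Phi R u by rewrite subr_ge0 Phi_le1.
by rewrite /stein_sol; case: ifP => _; rewrite mulr_ge0 ?divr_ge0 ?Phi_ge0 ?(ltW (phi_gt0 _)).
Qed.

(** On each side of [w], the monotonicity of [Phi] allows exchanging the factor
    that depends on [w] with the one that depends on [x], so that one of the two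
    Mills ratios appears according to the sign of [x]. *)
Lemma stein_sol_bounded w x : stein_sol w x <= Mills_const.
Proof.
have h u : 0 <= 1 - @Phi R u by rewrite subr_ge0 Phi_le1.
have p0 := phi_gt0 x.
have hR : Phi w <= Phi x -> 0 <= x -> Phi w * ((1 - Phi x) / phi x) <= Mills_const.
  move=> _ x0; apply: le_trans (Mills_upper_bounded x0).
  by rewrite ler_piMl ?Phi_le1// divr_ge0// ltW.
rewrite /stein_sol; case: (leP x w) => xw; have [x0|x0] := leP 0 x.
- apply: le_trans (Mills_upper_bounded x0).
  rewrite mulrA ler_wpM2r ?invr_ge0 ?(ltW p0)//.
  have := Phi_nondecreasing xw; have := Phi_le1 x; have := Phi_ge0 x; have := Phi_le1 w; nra.
- apply: le_trans (Mills_lower_bounded (ltW x0)).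
  by rewrite ler_piMl ?gerBl ?Phi_ge0// divr_ge0 ?Phi_ge0// ltW.
- by apply: hR => //; apply: Phi_nondecreasing; exact: ltW.
- apply: le_trans (Mills_lower_bounded (ltW x0)).
  rewrite mulrA ler_wpM2r ?invr_ge0 ?(ltW p0)//.
  have := Phi_nondecreasing (ltW xw); have := Phi_le1 x; have := Phi_ge0 x; have := Phi_ge0 w; nra.
Qed.

Lemma stein_sol_mulx w x : `|x * stein_sol w x| <= 1.
Proof.
have h u : 0 <= 1 - @Phi R u by rewrite subr_ge0 Phi_le1.
have p0 := phi_gt0 x.
rewrite normrM (ger0_norm (stein_sol_ge0 w x)).
have up : 0 <= x -> `|x| * ((1 - Phi x) / phi x) <= 1.
  by move=> x0; rewrite ger0_norm// mulrA ler_pdivrMr// mul1r Mills_upper.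
have lo : x <= 0 -> `|x| * (Phi x / phi x) <= 1.
  by move=> x0; rewrite ler0_norm// mulrA ler_pdivrMr// mul1r Mills_lower.
rewrite /stein_sol; case: (leP x w) => xw; have [x0|x0] := leP 0 x.
- apply: le_trans (up x0); rewrite ler_wpM2l// mulrA ler_wpM2r ?invr_ge0 ?(ltW p0)//.
  have := Phi_nondecreasing xw; have := Phi_le1 x; have := Phi_ge0 x; have := Phi_le1 w; nra.
- apply: le_trans (lo (ltW x0)); rewrite ler_wpM2l//.
  by rewrite ler_piMl ?gerBl ?Phi_ge0// divr_ge0 ?Phi_ge0// ltW.
- apply: le_trans (up x0); rewrite ler_wpM2l//.
  by rewrite ler_piMl ?Phi_le1// divr_ge0// ltW.
- apply: le_trans (lo (ltW x0)); rewrite ler_wpM2l// mulrA ler_wpM2r ?invr_ge0 ?(ltW p0)//.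
  have := Phi_nondecreasing (ltW xw); have := Phi_le1 x; have := Phi_ge0 x; have := Phi_ge0 w; nra.
Qed.

(** Covers both branches of [stein_sol]: each is the restriction of a function of
    this form, differentiable on the whole line. *)
Lemma is_derive_Mills (a b x : R) :
  is_derive x 1 (fun y => (a + b * Phi y) / phi y)
    (x * ((a + b * Phi x) / phi x) + b).
Proof.
have h1 := is_derive_Phi x; have h2 := is_derive_phi x.
have p0 : phi x != 0 by rewrite gt_eqF ?phi_gt0.
have h3 := is_deriveV p0.
apply: is_derive_eq; rewrite /GRing.scale/=.
by field.
Qed.

Lemma stein_sol_left w x y : x < y -> y <= w ->
  exists c, [/\ x < c, c < y &
    stein_sol w y - stein_sol w x = (c * stein_sol w c + 1 - Phi w) * (y - x)].
Proof.
move=> xy yw.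
have [c [xc cy e]] := mean_value (is_derive_Mills 0 (1 - Phi w)) xy.
exists c; split => //; rewrite /stein_sol yw (ltW (lt_le_trans xy yw)) (ltW (lt_le_trans cy yw)).
by move: e; rewrite !add0r -!mulrA => ->; ring.
Qed.

Lemma stein_sol_right w x y : x < y -> w <= x ->
  exists c, [/\ x < c, c < y &
    stein_sol w y - stein_sol w x = (c * stein_sol w c - Phi w) * (y - x)].
Proof.
move=> xy wx.
have [c [xc cy e]] := mean_value (is_derive_Mills (Phi w) (- Phi w)) xy.
have h u : w <= u -> stein_sol w u = (Phi w + - Phi w * Phi u) / phi u.
  rewrite /stein_sol le_eqVlt => /predU1P[<-|wu]; first by rewrite lexx; field; rewrite gt_eqF ?phi_gt0.
  by rewrite leNgt wu/=; field; rewrite gt_eqF ?phi_gt0.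
exists c; split => //; rewrite !h// ?(le_trans wx) ?ltW//.
Qed.

Lemma stein_sol_lipschitz w x y : x <= y -> `|stein_sol w y - stein_sol w x| <= 2 * (y - x).
Proof.
have P0 := Phi_ge0 w; have P1 := Phi_le1 w.
have L u v : u <= v -> v <= w -> `|stein_sol w v - stein_sol w u| <= 2 * (v - u).
  rewrite le_eqVlt => /predU1P[->|uv vw]; first by rewrite !subrr normr0 mulr0.
  have [c [_ _ ->]] := stein_sol_left uv vw.
  rewrite normrM (gtr0_norm (x := v - u)) ?subr_gt0// ler_pM2r ?subr_gt0//.
  by have := stein_sol_mulx w c; rewrite !ler_norml => /andP[]; lra.
have G u v : u <= v -> w <= u -> `|stein_sol w v - stein_sol w u| <= 2 * (v - u).
  rewrite le_eqVlt => /predU1P[->|uv vw]; first by rewrite !subrr normr0 mulr0.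
  have [c [_ _ ->]] := stein_sol_right uv vw.
  rewrite normrM (gtr0_norm (x := v - u)) ?subr_gt0// ler_pM2r ?subr_gt0//.
  by have := stein_sol_mulx w c; rewrite !ler_norml => /andP[]; lra.
move=> xy; have [yw|wy] := leP y w; first exact: L.
have [wx|xw] := leP w x; first exact: G.
rewrite (_ : _ - _ = (stein_sol w y - stein_sol w w) + (stein_sol w w - stein_sol w x)); last by ring.
apply: le_trans (ler_normD _ _) _.
have := L x w (ltW xw) (lexx _); have := G w y (ltW wy) (lexx _); lra.
Qed.

(** The increment of [f = stein_sol w] over a short interval is predicted by
    Stein's equation at its left end. The error is of second order, as
    [x f(x)] is locally Lipschitz, except over an interval that contains the
    jump of [f'] at [w], where it is of first order. *)
Lemma stein_sol_taylor w x y : x < y ->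
  `|stein_sol w y - stein_sol w x
     - (x * stein_sol w x + (x <= w)%R%:R - Phi w) * (y - x)|
  <= (Mills_const + 2 * `|x|) * (y - x) ^+ 2 + 4 * (y - x) * (x <= w < y)%R%:R.
Proof.
move=> xy; have P0 := Phi_ge0 w; have P1 := Phi_le1 w.
have yx0 : 0 < y - x by rewrite subr_gt0.
have M0 := Mills_const_ge0.
have near c : x < c -> c < y ->
    `|c * stein_sol w c - x * stein_sol w x| <= (Mills_const + 2 * `|x|) * (y - x).
  move=> xc cy; rewrite (_ : _ - _ = (c - x) * stein_sol w c + x * (stein_sol w c - stein_sol w x)); last by ring.
  apply: le_trans (ler_normD _ _) _; rewrite !normrM (gtr0_norm (x := c - x)) ?subr_gt0//.
  rewrite (ger0_norm (stein_sol_ge0 _ _)) [leRHS]mulrDl; apply: lerD.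
    by rewrite mulrC; apply: ler_pM; rewrite ?stein_sol_ge0 ?subr_ge0 ?stein_sol_bounded ?lerD2r ?(ltW xc) ?(ltW cy).
  rewrite (mulrC 2) -mulrA ler_wpM2l// (le_trans (stein_sol_lipschitz _ (ltW xc)))//.
  by rewrite ler_pM2l// lerD2r ltW.
have [yw|wy] := leP y w.
  have xw : x <= w := ltW (lt_le_trans xy yw).
  have [c [xc cy ->]] := stein_sol_left xy yw.
  rewrite xw /= mulr0 addr0 -mulrBl normrM (gtr0_norm yx0) expr2 mulrA ler_pM2r//.
  by apply: le_trans (near c xc cy); rewrite le_eqVlt; apply/predU1P; left; congr `|_|; ring.
have [xw|wx] := leP x w; last first.
  have [c [xc cy ->]] := stein_sol_right xy (ltW wx).
  rewrite /= mulr0 !addr0 -mulrBl normrM (gtr0_norm yx0) expr2 mulrA ler_pM2r//.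
  by apply: le_trans (near c xc cy); rewrite le_eqVlt; apply/predU1P; left; congr `|_|; ring.
have T0 : 0 <= (Mills_const + 2 * `|x|) * (y - x) ^+ 2.
  by rewrite mulr_ge0 ?sqr_ge0// addr_ge0// mulr_ge0.
rewrite /= mulr1; apply: (@le_trans _ _ (4 * (y - x))); last by rewrite lerDr.
apply: le_trans (ler_normB _ _) _; rewrite normrM (gtr0_norm yx0).
have : `|x * stein_sol w x + 1 - Phi w| <= 2.
  by have := stein_sol_mulx w x; rewrite !ler_norml => /andP[]; lra.
move=> /(ler_wpM2r (ltW yx0)).
have := stein_sol_lipschitz w (ltW xy); lra.
Qed.

End SteinSolution.

(** * Perturbations of the normal distribution function *)

Section PhiPerturbation.
Variable R : realType.
Implicit Types x y w r e : R.

Lemma phi_le1 x : phi x <= 1.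
Proof.
rewrite /phi; apply: mulr_ile1; rewrite ?expR_ge0 ?invr_ge0//.
  rewrite invf_le1 ?sqrtr_gt0 ?mulr_gt0 ?pi_gt0// -[leLHS]sqrtr1 ler_sqrt ?mulr_ge0 ?pi_ge0//.
  by have := @pi_ge2 R; lra.
by rewrite -[leRHS]expR0 ler_expR oppr_le0 mulr_ge0 ?sqr_ge0.
Qed.

Lemma mul_phi_le1 x : `|x| * phi x <= 1.
Proof.
rewrite /phi expRN mulrCA; apply: mulr_ile1; rewrite ?invr_ge0 ?mulr_ge0 ?invr_ge0 ?expR_ge0//.
  rewrite invf_le1 ?sqrtr_gt0 ?mulr_gt0 ?pi_gt0// -[leLHS]sqrtr1 ler_sqrt ?mulr_ge0 ?pi_ge0//.
  by have := @pi_ge2 R; lra.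
rewrite ler_pdivrMr ?expR_gt0// mul1r; apply: le_trans (expR_ge1Dx _).
rewrite -(real_normK (num_real x)); have := sqr_ge0 (`|x| - 1); lra.
Qed.

Lemma Phi_lipschitz x y : `|Phi x - Phi y| <= `|x - y|.
Proof.
wlog xy : x y / y < x => [h|].
  have [xy|xy|->] := ltgtP y x; last by rewrite !subrr.
    exact: h.
  by rewrite distrC [leRHS]distrC; exact: h.
have [c [_ _ ->]] := mean_value (@is_derive_Phi R) xy.
by rewrite normrM ler_piMl// ger0_norm ?phi_le1 ?ltW ?phi_gt0.
Qed.

(** By the mean value theorem, the increment is [(r - 1) * w * phi c] with
    [|w| <= |c|], and [|c| * phi c <= 1]. *)
Lemma Phi_scale w r : 1 <= r -> `|Phi (r * w) - Phi w| <= r - 1.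
Proof.
rewrite le_eqVlt => /predU1P[<-|r1]; first by rewrite mul1r !subrr normr0.
have r0 : 0 <= r - 1 by rewrite subr_ge0 ltW.
have key c : `|w| <= `|c| -> `|phi c * ((r - 1) * w)| <= r - 1.
  move=> wc; rewrite mulrCA normrM (ger0_norm r0) ler_piMr// normrM mulrC.
  rewrite (ger0_norm (ltW (phi_gt0 c))); apply: le_trans (mul_phi_le1 c).
  by rewrite ler_wpM2r// ltW ?phi_gt0.
have [w0|w0|->] := ltgtP w 0; last by rewrite mulr0 subrr normr0.
- have rw : r * w < w by rewrite -[ltRHS]mul1r ltr_nM2r.
  have [c [c1 c2 e]] := mean_value (@is_derive_Phi R) rw.
  rewrite distrC e -normrN -mulrN opprB -[X in _ - X]mul1r -mulrBl.
  by apply: key; rewrite (ltr0_norm w0) (ltr0_norm (lt_trans c2 w0)) lerN2 ltW.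
- have rw : w < r * w by rewrite -[ltLHS]mul1r ltr_pM2r.
  have [c [c1 c2 ->]] := mean_value (@is_derive_Phi R) rw.
  rewrite -[X in _ - X]mul1r -mulrBl.
  by apply: key; rewrite (gtr0_norm w0) (gtr0_norm (lt_trans w0 c1)) ltW.
Qed.

Lemma Phi_perturb w r e : 1 <= r -> `|Phi (r * w + e) - Phi w| <= `|e| + (r - 1).
Proof.
move=> r1; rewrite (_ : _ - _ = (Phi (r * w + e) - Phi (r * w)) + (Phi (r * w) - Phi w)); last by ring.
apply: le_trans (ler_normD _ _) _; apply: lerD; last exact: Phi_scale.
by apply: le_trans (Phi_lipschitz _ _) _; rewrite addrC addKr.
Qed.

End PhiPerturbation.

(** * Normal approximation from the approximate Poisson identity *)

Section NormalApproximation.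
(** [W] is any random variable with values in the natural numbers, on a finite
    uniform space, that nearly satisfies the identity which characterizes the
    Poisson law of parameter [lam]. *)
Variables (R : realType) (T : finType) (W : T -> nat) (lam B : R).
Hypotheses (T0 : (0 < #|T|)%N) (lam1 : 1 <= lam).
Hypothesis stein_W : forall (g : nat -> R) (D : R),
  (forall k, `|g k.+1 - g k| <= D) ->
  `|mean (fun s => (W s)%:R * g (W s)) - lam * mean (fun s => g (W s).+1)| <= B * D.

Let lam0 : 0 < lam. Proof. exact: lt_le_trans lam1. Qed.
Let sq0 : 0 < Num.sqrt lam. Proof. by rewrite sqrtr_gt0. Qed.
Let sqK : Num.sqrt lam * Num.sqrt lam = lam.
Proof. by rewrite -expr2 sqr_sqrtr// ltW. Qed.
Let sq1 : 1 <= Num.sqrt lam.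
Proof. by rewrite -[leLHS]sqrtr1 ler_sqrt ?lam1 ?ltW. Qed.

Let id_incr k : `|(k.+1)%:R - k%:R| <= 1 :> R.
Proof. by rewrite -natr1 addrC addKr normr1. Qed.

Let B0 : 0 <= B.
Proof. by have := le_trans (normr_ge0 _) (stein_W id_incr); rewrite mulr1. Qed.

Lemma mean_W : mean (fun s => (W s)%:R) = lam.
Proof.
have := @stein_W (fun=> 1) 0; rewrite mulr0 mean_cst// mulr1.
have -> : mean (fun s => (W s)%:R * 1 : R) = mean (fun s => (W s)%:R).
  by apply: eq_mean => s; rewrite mulr1.
move=> h; apply/eqP; rewrite -subr_eq0 -normr_le0; apply: h => k.
by rewrite subrr normr0.
Qed.

(** The hypothesis for [g k = k]. *)
Lemma mean_sqr_dev : mean (fun s => ((W s)%:R - lam) ^+ 2) <= lam + B.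
Proof.
have := stein_W id_incr; rewrite mulr1.
have -> : mean (fun s => (W s).+1%:R : R) = lam + 1.
  by rewrite -mean_W -[X in _ + X](mean_cst T0) -meanD; apply: eq_mean => s; rewrite natr1.
have -> : mean (fun s => ((W s)%:R - lam) ^+ 2) =
    mean (fun s => (W s)%:R * (W s)%:R) - lam * lam.
  transitivity (mean (fun s => (W s)%:R * (W s)%:R + (- (2 * lam) * (W s)%:R + lam * lam))).
    by apply: eq_mean => s; ring.
  by rewrite !meanD (meanZ (- (2 * lam))) mean_W mean_cst//; ring.
by rewrite ler_norml => /andP[_]; lra.
Qed.

Lemma mean_abs_dev : mean (fun s => `|(W s)%:R - lam|) <= Num.sqrt lam * (1 + B / 2).
Proof.
have h (s : T) : `|(W s)%:R - lam| <= 2^-1 * Num.sqrt lam + (2 * Num.sqrt lam)^-1 * ((W s)%:R - lam) ^+ 2.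
  rewrite -(real_normK (num_real ((W s)%:R - lam))); set x := `|_|.
  rewrite -(@ler_pM2l _ (2 * Num.sqrt lam)) ?mulr_gt0// mulrDr mulVKf ?gt_eqF ?mulr_gt0//.
  have : 0 <= (Num.sqrt lam - x) ^+ 2 by exact: sqr_ge0.
  by lra.
apply: le_trans (ler_mean h) _.
rewrite meanD mean_cst// meanZ mulrDr mulr1.
have := mean_sqr_dev; rewrite -(@ler_pM2l _ (2 * Num.sqrt lam)^-1) ?invr_gt0 ?mulr_gt0//.
move=> hv; apply: le_trans (lerD (lexx _) hv) _.
have -> : (2 * Num.sqrt lam)^-1 * (lam + B) = 2^-1 * Num.sqrt lam + (2 * Num.sqrt lam)^-1 * B.
  by rewrite -{2}sqK; field; rewrite gt_eqF.
have : (2 * Num.sqrt lam)^-1 * B <= Num.sqrt lam * (B / 2).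
  have -> : (2 * Num.sqrt lam)^-1 * B = (Num.sqrt lam)^-1 * (B / 2).
    by field; rewrite gt_eqF.
  by rewrite ler_wpM2r ?divr_ge0//; apply: le_trans sq1; rewrite invf_le1.
by lra.
Qed.

(** The hypothesis for the step [g] that jumps at [k0], whose increment is the
    indicator of [k0]: it bounds [lam * P(W = k0)] by the mean absolute
    deviation of [W]. *)
Lemma point_mass k0 : mean (fun s => (W s == k0)%:R) <= (1 + 3 / 2 * B) / Num.sqrt lam.
Proof.
pose g k : R := (k0 < k)%N%:R.
have hg k : `|g k.+1 - g k| <= 1.
  by rewrite /g; do 2 case: (leqP _ _) => _; rewrite ?subrr ?normr0 ?subr0 ?sub0r ?normrN ?normr1.
have := stein_W hg; rewrite mulr1.
have -> : mean (fun s => g (W s).+1) = mean (fun s => (W s == k0)%:R) + mean (fun s => g (W s)).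
  rewrite -meanD; apply: eq_mean => s; rewrite /g ltnS leq_eqVlt [_ == W s]eq_sym.
  by case: eqP => [->|_]; rewrite ?ltnn ?addr0 ?add0r.
set P := mean (fun s => (W s == k0)%:R).
have hd : `|mean (fun s => (W s)%:R * g (W s)) - lam * mean (fun s => g (W s))| <= Num.sqrt lam * (1 + B / 2).
  rewrite -meanZ -meanB; apply: le_trans (ler_norm_mean _) (le_trans (ler_mean _) mean_abs_dev) => s.
  rewrite -mulrBl normrM ler_piMr// /g; by case: (_ < _)%N; rewrite ?normr0 ?normr1.
move: hd; rewrite !ler_norml => /andP[_ h1] /andP[h2 _].
rewrite ler_pdivlMr//.
have h3 : lam * P <= B + Num.sqrt lam * (1 + B / 2) by move: h1 h2; lra.
rewrite -(@ler_pM2r _ (Num.sqrt lam))// -[P * _ * _]mulrA sqK [P * _]mulrC.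
apply: le_trans h3 _.
have := B0; have := sq1; nra.
Qed.

(** Stein's method. The hypothesis is applied to [g k = f (X k)], where [X] is the
    standardization of [W] and [f] solves Stein's equation. Its right-hand
    side involves [E (f (X (W + 1)) - f (X W))], and [stein_sol_taylor] turns this
    into [E (f' (X W))]. The jump of [f'] at [w] lies between [X W] and
    [X (W + 1)] for at most one value of [W], whose probability is bounded by
    [point_mass]. *)
Lemma normal_approximation w :
  `|mean (fun s => ((W s)%:R <= lam + w * Num.sqrt lam)%R%:R) - Phi w|
  <= (6 + 9 * B + Mills_const R) / Num.sqrt lam.
Proof.
pose d := (Num.sqrt lam)^-1.
have d0 : 0 < d by rewrite invr_gt0.
have d1 : d <= 1 by rewrite invf_le1.
have lamd : lam * d ^+ 2 = 1 by rewrite /d -{1}sqK; field; rewrite gt_eqF.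
have lamd' : lam * d = Num.sqrt lam by rewrite /d -{1}sqK; field; rewrite gt_eqF.
pose X k : R := (k%:R - lam) * d.
have XS k : X k.+1 - X k = d by rewrite /X -natr1; ring.
pose f := stein_sol w.
have hg k : `|f (X k.+1) - f (X k)| <= 2 * d.
  by rewrite -(XS k); apply: stein_sol_lipschitz; rewrite -subr_ge0 XS ltW.
have := stein_W hg.
set EW := mean (fun s => (W s)%:R * f (X (W s))).
set ES := mean (fun s => f (X (W s).+1)).
set E0 := mean (fun s => f (X (W s))).
move=> hS.
pose ind s : R := (X (W s) <= w)%R%:R.
pose ex s : R := (X (W s) <= w < X (W s).+1)%R%:R.
have t1 (s : T) : `|lam * d * (f (X (W s).+1) - f (X (W s))) -
    (X (W s) * f (X (W s)) + ind s - Phi w)| <=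
    Mills_const R * d + (2 * d * d * `|(W s)%:R - lam| + 4 * ex s).
  have Xlt : X (W s) < X (W s).+1 by rewrite -subr_gt0 XS.
  have := stein_sol_taylor w Xlt; rewrite XS -/f -/(ind s) -/(ex s).
  rewrite -(@ler_pM2l _ (lam * d)) ?mulr_gt0//.
  rewrite -{1}(@ger0_norm _ (lam * d)) ?mulr_ge0 ?(ltW lam0) ?(ltW d0)// -normrM mulrBr.
  have -> : lam * d * ((X (W s) * f (X (W s)) + ind s - Phi w) * d) = X (W s) * f (X (W s)) + ind s - Phi w.
    by set Y := (_ - Phi w); rewrite -[RHS]mul1r -lamd; ring.
  move=> /le_trans; apply; rewrite le_eqVlt; apply/predU1P; left.
  rewrite /X normrM (ger0_norm (ltW d0)).
  set a := `|_|; set e := ex s.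
  transitivity (lam * d ^+ 2 * ((Mills_const R + 2 * (a * d)) * d + 4 * e)); first by ring.
  by rewrite lamd; ring.
have hXf : mean (fun s => X (W s) * f (X (W s))) = d * (EW - lam * E0).
  by rewrite /EW /E0 -meanZ -meanB -meanZ; apply: eq_mean => s; rewrite /X; ring.
have := le_trans (ler_norm_mean _) (ler_mean t1).
rewrite [X in `|X| <= _](_ : _ = lam * d * (ES - E0) - (d * (EW - lam * E0) + mean ind - Phi w)); last first.
  rewrite meanB (meanZ (lam * d)) meanB [X in _ - X = _]meanB meanD hXf.
  by rewrite (mean_cst T0).
rewrite [X in _ <= X -> _](_ : _ = Mills_const R * d + (2 * d * d * mean (fun s => `|(W s)%:R - lam|) + 4 * mean ex)); last first.
  by rewrite meanD (mean_cst T0) meanD !meanZ.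
have hex : mean ex <= (1 + 3 / 2 * B) * d.
  have [s0 hs0|none] := pickP (fun s => X (W s) <= w < X (W s).+1)%R; last first.
    rewrite (_ : mean ex = 0) ?mulr_ge0 ?(ltW d0)//; first by have := B0; lra.
    by rewrite -(mean_cst T0 0); apply: eq_mean => s; rewrite /ex none.
  apply: le_trans (point_mass (W s0)); apply: ler_mean => s; rewrite /ex.
  have [hs|_] := boolP (X (W s) <= w < X (W s).+1)%R; last by rewrite ler0n.
  have Xm i j : X i < X j -> (i < j)%N.
    by rewrite /X ltr_pM2r// ltrD2r ltr_nat.
  case/andP: hs0 => a0 b0; case/andP: hs => a1 b1.
  have := Xm _ _ (le_lt_trans a0 b1); have := Xm _ _ (le_lt_trans a1 b0).
  by rewrite !ltnS => h1 h2; rewrite (_ : W s = W s0) ?eqxx//; apply/eqP; rewrite eqn_leq h1 h2.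
have -> : mean (fun s => ((W s)%:R <= lam + w * Num.sqrt lam)%R%:R) = mean ind.
  apply: eq_mean => s; rewrite /ind /X /d ler_pdivrMr// lerBlDl.
  by [].
have hdev : d * mean (fun s => `|(W s)%:R - lam|) <= 1 + B / 2.
  by rewrite mulrC ler_pdivrMr// mulrC; exact: mean_abs_dev.
have hS' : `|d * (EW - lam * ES)| <= 2 * B * d.
  rewrite normrM (ger0_norm (ltW d0)).
  apply: le_trans (ler_wpM2l (ltW d0) hS) _.
  have : d * d * B <= d * B by rewrite ler_wpM2r ?B0// ler_piMl// ltW.
  by lra.
rewrite -/d -/(E0).
move: hS' hdev hex; set m := mean (fun s => `|_|); set P := mean ind; set e := mean ex => hS' hdev hex ht.
have hm : 2 * d * d * m <= 2 * d * (1 + B / 2) by rewrite -mulrA ler_wpM2l ?mulr_ge0// ltW.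
have : `|P - Phi w + (d * (EW - lam * ES))| <= Mills_const R * d + (2 * d * d * m + 4 * e).
  apply: le_trans ht; rewrite distrC; rewrite le_eqVlt; apply/predU1P; left; congr `|_|; ring.
move: hS'; rewrite !ler_norml => /andP[? ?] /andP[? ?]; apply/andP; split; lra.
Qed.

End NormalApproximation.

(** * Short and long cycles together *)

Section Assembly.
Variable R : realType.
Implicit Types (I J : {fset nat}) (n : nat).

Lemma cycle_count_split I J n (s : 'S_n) : (J `<=` I)%fset ->
  cycle_count I s = (cycle_count J s + cycle_count (I `\` J)%fset s)%N.
Proof.
move=> JI; rewrite !cycle_count_cycles_on /cycles_on -big_split/=; apply: eq_bigr => c _.
rewrite inE; have [/(fsubsetP JI) ->|] := boolP (#|c| \in J); first by [].
by case: (_ \in I).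
Qed.

Lemma Hsum_split I J : (J `<=` I)%fset -> Hsum R I = Hsum R J + Hsum R (I `\` J)%fset.
Proof.
move=> JI; rewrite /Hsum (big_fsetID _ (mem J))/=; congr (_ + _); apply: eq_fbigl => j; rewrite !inE/=.
  by apply: andb_idl => /(fsubsetP JI).
by rewrite andbC.
Qed.

(** For lengths at most [n / H], the set [I] has at most [n / H] elements, which
    makes the error in [avg_stein] at most [5 * D]. *)
Lemma short_cycles_normal I n (H v : R) : (0 < n)%N -> (I `<=` interval1 n)%fset ->
  2 <= H -> Hsum R I <= H -> 1 <= Hsum R I -> (forall j, j \in I -> j%:R * H <= n%:R) ->
  `|unifP R (fun s : 'S_n => (cycle_count I s)%:R <= Hsum R I + v * Num.sqrt (Hsum R I)) - Phi v|
    <= (51 + Mills_const R) / Num.sqrt (Hsum R I).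
Proof.
move=> n0 In H2 HI HI1 hI; have H0 : 0 < H by lra.
have n0R : 0 < n%:R :> R by rewrite ltr0n.
rewrite unifP_mean.
rewrite (_ : 51 + _ = 6 + 9 * 5 + Mills_const R); last by ring.
apply: normal_approximation => //; first exact: perm_gt0.
move=> g D gD; have D0 : 0 <= D by exact: le_trans (gD 0%N).
have I2 j : j \in I -> (2 * j <= n)%N.
  move=> jI; rewrite -(ler_nat R) natrM mulrC; apply: le_trans (hI _ jI).
  by rewrite ler_wpM2l.
apply: le_trans (avg_stein n0 In I2 gD) _.
rewrite mulrA ler_pdivrMr//.
have := card_small_le H0 In hI; set c := (#|` I|)%:R => cH.
have c0 : 0 <= c by rewrite /c.
have : Hsum R I * c <= n%:R by apply: le_trans cH; rewrite mulrC ler_wpM2l.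
move=> /(ler_wpM2r (mulr_ge0 (ler0n R 5) D0)); lra.
Qed.

Lemma unifP_ge0 (T : finType) (E : pred T) : 0 <= unifP R E.
Proof. by rewrite /unifP divr_ge0. Qed.

Lemma unifP_le1 n (E : pred 'S_n) : unifP R E <= 1.
Proof.
rewrite unifP_mean; apply: mean_le_cst; first exact: perm_gt0.
by move=> s; case: (E s).
Qed.

Lemma ln4_le3 : ln (4 : R) <= 3.
Proof. by rewrite (_ : 4 = 1 + 3); [apply: le_ln1Dx; lra|ring]. Qed.

Lemma ln_ge_half (x : R) : 2 <= x -> 2^-1 <= ln x.
Proof.
move=> x2; rewrite -[leLHS]expRK ler_ln ?posrE ?expR_gt0//; last by lra.
exact: le_trans (expR_half_le2 R) _.
Qed.

Lemma ln_ge1 (x : R) : 4 <= x -> 1 <= ln x.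
Proof.
move=> x4; rewrite -[leLHS]expRK ler_ln ?posrE ?expR_gt0//; last by lra.
apply: le_trans x4; rewrite [X in expR X](_ : _ = 2^-1 + 2^-1); last by field.
rewrite expRD (_ : 4 = 2 * 2); last by ring.
by apply: ler_pM; rewrite ?expR_ge0 ?expR_half_le2.
Qed.

Lemma ln_half_le (x : R) : 12 <= x -> 1 + ln x <= x / 2.
Proof.
move=> x12; have x4 : 0 < x / 4 by lra.
have -> : ln x = ln (x / 4) + ln 4.
  by rewrite -lnM ?posrE// divfK.
have : ln (x / 4) <= x / 4 - 1.
  rewrite [X in ln X](_ : _ = 1 + (x / 4 - 1)); last by ring.
  by apply: le_ln1Dx; lra.
have := ln4_le3; lra.
Qed.

(** Counting also the cycles of lengths in [I :\: J] can only decrease the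
    probability of a lower tail, and it shifts the count by more than [A] with
    exponentially small probability. *)
Lemma unifP_split_le I J n (t : R) : (J `<=` I)%fset ->
  unifP R (fun s : 'S_n => (cycle_count I s)%:R <= t) <=
  unifP R (fun s : 'S_n => (cycle_count J s)%:R <= t).
Proof.
move=> JI; rewrite !unifP_mean; apply: ler_mean => u.
have cJ : (cycle_count J u)%:R <= (cycle_count I u)%:R :> R.
  by rewrite (cycle_count_split u JI) ler_nat leq_addr.
by rewrite /= ler_nat; have [h|//] := leP (cycle_count I u)%:R t; rewrite (le_trans cJ h).
Qed.

Lemma unifP_split_ge I J n (t A : R) : (J `<=` I)%fset ->
  unifP R (fun s : 'S_n => (cycle_count J s)%:R <= t - A) <=
  unifP R (fun s : 'S_n => (cycle_count I s)%:R <= t)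
    + expR (Hsum R (I `\` J)%fset - A / 2).
Proof.
move=> JI; apply: le_trans (lerD (lexx _) (tail_bound (I `\` J)%fset n A)).
rewrite !unifP_mean -meanD; apply: ler_mean => u.
rewrite /= (cycle_count_split u JI) natrD.
set a := (cycle_count J u)%:R; set b := (cycle_count _ u)%:R.
have [h1|_] := leP a (t - A); last by rewrite addr_ge0.
have [h2|h2] := ltP A b; first by rewrite lerDr.
by rewrite (_ : a + b <= t) ?lerDl//; lra.
Qed.

Lemma sqrt_ratio_le (lam mu : R) : 1 <= lam -> 0 <= mu ->
  1 <= Num.sqrt (lam + mu) / Num.sqrt lam <= 1 + mu / Num.sqrt lam.
Proof.
move=> lam1 mu0; have lam0 : 0 < lam := lt_le_trans ltr01 lam1.
have sl0 : 0 < Num.sqrt lam by rewrite sqrtr_gt0.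
have sl1 : 1 <= Num.sqrt lam by rewrite -[leLHS]sqrtr1 ler_sqrt// ltW.
have slsq : Num.sqrt lam * Num.sqrt lam = lam by rewrite -expr2 sqr_sqrtr// ltW.
rewrite ler_pdivlMr// mul1r ler_sqrt; last by rewrite addr_ge0// ltW.
rewrite lerDl mu0/= ler_pdivrMr// mulrDl mul1r divfK ?gt_eqF//.
have y0 : 0 <= Num.sqrt lam + mu by rewrite addr_ge0// ltW.
rewrite -[leRHS]ger0_norm// -sqrtr_sqr ler_sqrt ?sqr_ge0//.
rewrite sqrrD [Num.sqrt lam ^+ 2]expr2 slsq.
have : mu <= Num.sqrt lam * mu by rewrite ler_peMl.
by have := sqr_ge0 mu; lra.
Qed.

(** The cutoff for short cycles is [n / H], which leaves out a harmonic sum [mu]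
    of order [ln H], at most [H / 2] when [12 <= H]. The margin [3 * ln H] for the
    long cycles is chosen to make the tail bound [expR (mu - 3 / 2 * ln H)] of
    order [H ^ (- 1 / 2)]. *)
Lemma central_limit_large n I w : (0 < n)%N -> (I `<=` interval1 n)%fset ->
  12 <= Hsum R I ->
  `| unifP R (fun s : 'S_n =>
       (cycle_count I s)%:R <= Hsum R I + w * Num.sqrt (Hsum R I)) - Phi w |
  <= (112 + 2 * Mills_const R + expR 1) * (ln (Hsum R I) / Num.sqrt (Hsum R I)).
Proof.
move=> n0 In; set H := Hsum R I => H12.
set L := ln H; set s := Num.sqrt H.
have H0 : 0 < H by lra.
pose J := [fset j in I | j%:R * H <= n%:R]%fset.
have JI : (J `<=` I)%fset by apply/fsubsetP => j; rewrite !inE => /andP[].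
have Jn : (J `<=` interval1 n)%fset by exact: fsubset_trans In.
have hJ j : j \in J -> j%:R * H <= n%:R by rewrite !inE => /andP[].
set lam := Hsum R J; pose mu := Hsum R (I `\` J)%fset.
have Hlm : H = lam + mu by exact: Hsum_split.
have mu0 : 0 <= mu by exact: Hsum_ge0.
have muL : mu <= 1 + L.
  apply: (@Hsum_large_le R _ n); first by lra.
    by apply: fsubset_trans In; exact: fsubsetDl.
  by move=> j; rewrite !inE negb_and => /andP[+ jI]; rewrite jI/= real_ltNge ?num_real.
have L1 : 1 <= L by apply: ln_ge1; lra.
have L0 : 0 <= L := le_trans ler01 L1.
have LH : 1 + L <= H / 2 by exact: ln_half_le.
have lam1 : 1 <= lam by lra.
have H2 : 2 <= H by lra.
have lam_le_H : lam <= H by lra.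
have s0 : 0 < s by rewrite sqrtr_gt0.
have sl0 : 0 < Num.sqrt lam by rewrite sqrtr_gt0; lra.
pose z := s^-1; have z0 : 0 < z by rewrite invr_gt0.
pose d := (Num.sqrt lam)^-1; have d0 : 0 < d by rewrite invr_gt0.
have dz : d <= 2 * z.
  rewrite ler_pdivlMr// mulrC ler_pdivrMr//.
  rewrite (_ : 2 = Num.sqrt (2 ^+ 2)); last by rewrite sqrtr_sqr ger0_norm.
  by rewrite -sqrtrM// ler_sqrt ?mulr_ge0//; lra.
pose r := s * d.
have /andP[r1 rd] : 1 <= r <= 1 + mu * d.
  by rewrite /r /s /d Hlm; exact: sqrt_ratio_le.
have normal v := short_cycles_normal v n0 Jn H2 lam_le_H lam1 hJ.
rewrite -/lam -/d in normal.
set t := H + w * s.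
set P := unifP R _.
pose A := 3 * L.
have Es : expR (mu - A / 2) <= expR 1 * z.
  apply: (@le_trans _ _ (expR (1 - L / 2))); first by rewrite ler_expR /A; lra.
  rewrite expRD ler_wpM2l ?expR_ge0// expRN.
  suff -> : expR (L / 2) = s by [].
  rewrite /s -[H in RHS]lnK ?posrE// -/L [L in RHS](_ : L = L / 2 + L / 2); last by field.
  by rewrite expRD -expr2 sqrtr_sqr ger0_norm ?expR_ge0.
(* The threshold [t - e], standardized with the parameter [lam]. *)
have tE e : t - e = lam + (r * w + (mu - e) * d) * Num.sqrt lam.
  by rewrite /t /r /d Hlm; field; rewrite gt_eqF.
have up : P <= unifP R (fun u : 'S_n => (cycle_count J u)%:R <= lam + (r * w + (mu - 0) * d) * Num.sqrt lam).
  by rewrite -tE subr0; exact: unifP_split_le.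
have lo : unifP R (fun u : 'S_n => (cycle_count J u)%:R <= lam + (r * w + (mu - A) * d) * Num.sqrt lam)
   <= P + expR (mu - A / 2).
  by rewrite -tE; exact: unifP_split_ge.
have m1 := normal (r * w + (mu - 0) * d); have m2 := normal (r * w + (mu - A) * d).
have p1 := Phi_perturb w ((mu - 0) * d) r1; have p2 := Phi_perturb w ((mu - A) * d) r1.
have shift x : `|x| <= 3 * L -> `|x * d| <= 3 * (L * d).
  by move=> xL; rewrite normrM (ger0_norm (ltW d0)) mulrA ler_wpM2r// ltW.
have b1 : `|(mu - 0) * d| <= 3 * (L * d).
  by apply: shift; rewrite subr0 ger0_norm//; clear -muL L1; lra.
have b2 : `|(mu - A) * d| <= 3 * (L * d).
  by apply: shift; rewrite ler_norml /A; clear -muL mu0 L1; lra.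
have Ld : L * d <= 2 * (L * z) by rewrite mulrCA ler_wpM2l.
have mud : mu * d <= 2 * (L * d).
  by rewrite mulrA ler_wpM2r ?(ltW d0)//; clear -muL L1; lra.
have zL : z <= L * z by rewrite ler_peMl// ltW.
have c1 : (51 + Mills_const R) * d <= (51 + Mills_const R) * (2 * (L * z)).
  apply: ler_wpM2l; first by rewrite addr_ge0 ?Mills_const_ge0.
  by apply: le_trans dz _; apply: ler_wpM2l.
have c2 : expR 1 * z <= expR 1 * (L * z) by rewrite ler_wpM2l ?expR_ge0.
have e0 : 0 <= expR 1 * (L * z) by rewrite !mulr_ge0 ?expR_ge0 ?(ltW z0).
move: m1 m2 p1 p2; rewrite !ler_norml.
move=> /andP[m1 m1'] /andP[m2 m2'] /andP[p1 p1'] /andP[p2 p2'].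
move: up lo m1 m1' m2 m2' p1 p1' p2 p2' b1 b2 c1 c2 Es e0 Ld mud rd; rewrite -/z.
set U1 := unifP _ _; set U2 := unifP _ _; set F1 := Phi _; set F2 := Phi _; set F := Phi w.
set B1 := `|_|; set B2 := `|_|; set E := expR (_ - _); set Mc := Mills_const R.
set e := expR 1; set Lz := L * z; set Ld := L * d.
clearbody U1 U2 F1 F2 F B1 B2 E Mc e Lz Ld P z d r mu.
by clear; move=> *; apply/andP; split; lra.
Qed.

End Assembly.

Theorem theorem1p21 (R : realType) :
  exists K : R, forall (n : nat) (I : {fset nat}) (w : R),
    (1 <= n)%N ->
    (I `<=` interval1 n)%fset ->
    3 <= Hsum R I ->
    `| unifP R (fun s : 'S_n =>
         (cycle_count I s)%:R <= Hsum R I + w * Num.sqrt (Hsum R I))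
       - Phi w |
    <= K * (ln (Hsum R I) / Num.sqrt (Hsum R I)).
Proof.
exists (112 + 2 * Mills_const R + expR 1) => n I w n0 In H3.
have [H12|H12] := leP 12 (Hsum R I); first exact: central_limit_large.
(* For bounded [H] the constant absorbs the trivial bound 1. *)
set H := Hsum R I in H3 H12 *; set p := unifP R _.
have s0 : 0 < Num.sqrt H by rewrite sqrtr_gt0; lra.
have Mc0 := Mills_const_ge0 R.
have e0 : 0 <= expR (1 : R) by exact: expR_ge0.
have s4 : Num.sqrt H <= 4.
  rewrite (_ : 4 = Num.sqrt (4 ^+ 2)); last by rewrite sqrtr_sqr ger0_norm.
  by rewrite ler_sqrt ?exprn_ge0//; lra.
apply: (@le_trans _ _ 1).
  have := @unifP_le1 R n (fun s : 'S_n => (cycle_count I s)%:R <= H + w * Num.sqrt H).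
  have := @unifP_ge0 R _ (fun s : 'S_n => (cycle_count I s)%:R <= H + w * Num.sqrt H).
  rewrite -/p; have := Phi_ge0 w; have := Phi_le1 w.
  by move=> *; rewrite ler_norml; apply/andP; split; lra.
have lnH : 2^-1 <= ln H by apply: ln_ge_half; lra.
by rewrite mulrA ler_pdivlMr// mul1r; nra.
Qed.
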